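(* Let $d\geq 1$ be an integer, let $p\geq 2$ be a real number, and let $\{\varepsilon_{\boldsymbol{i}},\boldsymbol{i}\in\mathbb{Z}^d\}$ be an i.i.d. set of real random variables. Then for any measurable function $f\colon\mathbb{R}^{\mathbb{Z}^d}\to\mathbb{R}$ such that $X_{\boldsymbol{j}}:=f\left((\varepsilon_{\boldsymbol{j}-\boldsymbol{i}})_{\boldsymbol{i}\in\mathbb{Z}^d}\right)$ has a finite moment of order $p$ and is centered, and any $(a_{\boldsymbol{i}})_{\boldsymbol{i}\in\mathbb{Z}^d}\in\ell^2(\mathbb{Z}^d)$, $$\left\lVert\sum_{\boldsymbol{i}\in\mathbb{Z}^d}a_{\boldsymbol{i}}X_{\boldsymbol{i}}\right\rVert_p\leq\sqrt{2}\,\frac{14.5p}{\log p}\left(\sum_{\boldsymbol{i}\in\mathbb{Z}^d}a_{\boldsymbol{i}}^2\right)^{1/2}\sum_{j=0}^{+\infty}(4j+4)^{d/2}\left(\sum_{\lVert\boldsymbol{i}\rVert_\infty=j}\delta_{\boldsymbol{i},2}^2\right)^{1/2}+\sqrt{2}\,\frac{14.5p}{\log p}\sqrt{p-1}\left(\sum_{\boldsymbol{i}\in\mathbb{Z}^d}|a_{\boldsymbol{i}}|^p\right)^{1/p}\sum_{j=0}^{+\infty}(4j+4)^{d(1-1/p)}\left(\sum_{\lVert\boldsymbol{i}\rVert_\infty=j}\delta_{\boldsymbol{i},p}^2\right)^{1/2},$$ where $\delta_{\boldsymbol{i},q}$ denotes the physical dependence measure of $(X_{\boldsymbol{j}})_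{\boldsymbol{j}\in\mathbb{Z}^d}$.
   Context: For a random variable $Y$ and $q\geq 1$, $\lVert Y\rVert_q:=(\mathbb{E}[|Y|^q])^{1/q}$. For $\boldsymbol{i}=(i_1,\dots,i_d)\in\mathbb{Z}^d$, $\lVert\boldsymbol{i}\rVert_\infty:=\max_{1\leq q\leq d}|i_q|$, and $\boldsymbol{0}=(0,\dots,0)$. For $q\geq 1$, $\ell^q(\mathbb{Z}^d)$ is the space of real families $\boldsymbol{a}=(a_{\boldsymbol{i}})_{\boldsymbol{i}\in\mathbb{Z}^d}$ with $\left(\sum_{\boldsymbol{i}\in\mathbb{Z}^d}|a_{\boldsymbol{i}}|^q\right)^{1/q}<+\infty$. For a random field $(Y_{\boldsymbol{i}})_{\boldsymbol{i}\in\mathbb{Z}^d}$, the sum $\sum_{\boldsymbol{i}\in\mathbb{Z}^d}Y_{\boldsymbol{i}}$ is understood as the $\mathbb{L}^1$-limit, as $k\to\infty$, of $\sum_{\boldsymbol{i}\in\mathbb{Z}^d,\lVert\boldsymbol{i}\rVert_\infty\leq k}Y_{\boldsymbol{i}}$. Physical dependence measure: let $(\varepsilon'_{\boldsymbol{u}})_{\boldsymbol{u}\in\mathbb{Z}^d}$ be an i.i.d. random field independent of $(\varepsilon_{\boldsymbol{u}})_{\boldsymbol{u}\in\mathbb{Z}^d}$ and with the same distribution. Put $\varepsilon^*_{\boldsymbol{u}}=\varepsilon_{\boldsymbol{u}}$ if $\boldsymbol{u}\neq\boldsymbol{0}$ and $\varepsilon^*_{\boldsymbol{0}}=\varepsilon'_{\boldsymbol{0}}$,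 and $X^*_{\boldsymbol{i}}=f\left((\varepsilon^*_{\boldsymbol{i}-\boldsymbol{j}})_{\boldsymbol{j}\in\mathbb{Z}^d}\right)$. For $q\geq 1$ and $\boldsymbol{i}\in\mathbb{Z}^d$, $\delta_{\boldsymbol{i},q}:=\lVert X_{\boldsymbol{i}}-X^*_{\boldsymbol{i}}\rVert_q$. *)

(* Defs.v *)
From HB Require Import structures.
From mathcomp Require Import all_boot all_order all_algebra.
From mathcomp Require Import finmap zify.
From mathcomp Require Import all_classical all_reals all_analysis.

Set Implicit Arguments.
Unset Strict Implicit.
Unset Printing Implicit Defensive.

Import Order.TTheory GRing.Theory Num.Theory.
Import numFieldNormedType.Exports.

Local Open Scope classical_set_scope.
Local Open Scope ring_scope.

(* The lattice Z^d is the type 'rV[int]_d of integer row vectors. *)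

Definition supnorm (d : nat) (i : 'rV[int]_d) : nat :=
  (\max_(q < d) `|i ord0 q|%N)%N.

(* Boxes and spheres are finite, so that the finitely supported sums
   \sum_(i \in _) over them used below are genuine sums. *)
Lemma finite_box (d k : nat) :
  finite_set [set i : 'rV[int]_d | (supnorm i <= k)%N].
Proof.
pose F (g : {ffun 'I_d -> 'I_(k + k).+1}) : 'rV[int]_d :=
  \row_q ((g q)%:Z - k%:Z).
apply: (@sub_finite_set _ _ (F @` setT)); last first.
  exact/finite_image/finite_finset.
move=> i /= /bigmax_leqP ik.
exists [ffun q => inord (absz (i ord0 q + k%:Z))] => //.
apply/rowP => q; rewrite mxE ffunE.
have := ik q isT; move: (i ord0 q) => z zk.
by rewrite inordK; lia.
Qed.

Lemma finite_sphere (d k : nat) :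
  finite_set [set i : 'rV[int]_d | supnorm i = k].
Proof. by apply: sub_finite_set (finite_box d k) => i /= ->. Qed.

Local Open Scope ereal_scope.

Definition lq_norm (R : realType) (d : nat) (q : R) (a : 'rV[int]_d -> R)
  : \bar R :=
  (\esum_(i in [set: 'rV[int]_d]) (`|a i| `^ q)%:E) `^ q^-1.

Definition in_lq (R : realType) (d : nat) (q : R) (a : 'rV[int]_d -> R) : Prop :=
  lq_norm q a < +oo.

(* Generators of the product sigma-algebra of R^I. *)
Definition coordinate_sets (R : realType) (I : Type) : set_system (I -> R) :=
  [set C | exists i (B : set R), measurable B /\ C = [set x | B (x i)]].

Definition product_space (R : realType) (I : Type) :=
  g_sigma_algebraType (@coordinate_sets R I).

Definition mutually_independent (disp : measure_display)
    (T : measurableType disp) (R : realType) (P : probability T R)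
    (I : choiceType) (Y : I -> T -> R) : Prop :=
  forall (J : {fset I}) (B : I -> set R), (forall i, measurable (B i)) ->
    P (\bigcap_(i in [set` J]) Y i @^-1` B i) =
    \prod_(i <- J) P (Y i @^-1` B i).

Definition identically_distributed (disp : measure_display)
    (T : measurableType disp) (R : realType) (P : probability T R)
    (I : Type) (Y : I -> T -> R) : Prop :=
  forall (i j : I) (B : set R), measurable B ->
    P (Y i @^-1` B) = P (Y j @^-1` B).

Definition iid (disp : measure_display)
    (T : measurableType disp) (R : realType) (P : probability T R)
    (I : choiceType) (Y : I -> T -> R) : Prop :=
  mutually_independent P Y /\ identically_distributed P Y.

Definition sample_path (T R I : Type) (Y : I -> T -> R) : T -> I -> R :=
  fun w i => Y i w.

Definition same_field_law (disp : measure_display)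
    (T : measurableType disp) (R : realType) (P : probability T R)
    (I : Type) (Y Z : I -> T -> R) : Prop :=
  forall A : set (product_space R I), measurable A ->
    P (sample_path Y @^-1` A) = P (sample_path Z @^-1` A).

Definition independent_fields (disp : measure_display)
    (T : measurableType disp) (R : realType) (P : probability T R)
    (I : Type) (Y Z : I -> T -> R) : Prop :=
  forall A B : set (product_space R I), measurable A -> measurable B ->
    P (sample_path Y @^-1` A `&` sample_path Z @^-1` B) =
    P (sample_path Y @^-1` A) * P (sample_path Z @^-1` B).

Definition bernoulli_shift (T R : Type) (d : nat) (f : ('rV[int]_d -> R) -> R)
    (e : 'rV[int]_d -> T -> R) (j : 'rV[int]_d) : T -> R :=
  fun w => f (fun i => e (j - i)%R w).

Definition replace_origin (T R : Type) (d : nat) (e e' : 'rV[int]_d -> T -> R)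
    (u : 'rV[int]_d) : T -> R :=
  if u == 0%R then e' 0%R else e u.

Definition physical_dependence (disp : measure_display)
    (T : measurableType disp) (R : realType) (P : probability T R) (d : nat)
    (f : ('rV[int]_d -> R) -> R) (e e' : 'rV[int]_d -> T -> R)
    (i : 'rV[int]_d) (q : R) : \bar R :=
  'N[P]_(q%:E)[EFin \o (bernoulli_shift f e i \-
                        bernoulli_shift f (replace_origin e e') i)%R].

(* \sum_j (4j+4)^c (\sum_{|i|_oo = j} delta_{i,q}^2)^{1/2} *)
Definition dependence_series (disp : measure_display)
    (T : measurableType disp) (R : realType) (P : probability T R) (d : nat)
    (f : ('rV[int]_d -> R) -> R) (e e' : 'rV[int]_d -> T -> R)
    (c q : R) : \bar R :=
  \sum_(0 <= j <oo)
    (((4 * j + 4)%N%:R : R) `^ c)%:E *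
    (\sum_(i \in [set i : 'rV[int]_d | supnorm i = j])
       physical_dependence P f e e' i q ^+ 2) `^ 2^-1.

(* S is (a version of) \sum_{i in Z^d} Y_i, the L^1-limit of the sums over
   the boxes |i|_oo <= k. *)
Definition is_field_sum (disp : measure_display)
    (T : measurableType disp) (R : realType) (P : probability T R) (d : nat)
    (Y : 'rV[int]_d -> T -> R) (S : T -> R) : Prop :=
  S \in Lfun P 1 /\
  'N[P]_1[EFin \o (fun w =>
     (\sum_(i \in [set i : 'rV[int]_d | (supnorm i <= k)%N]) Y i w) - S w)%R]
    @[k --> \oo] --> 0.

(* For extended-real bounds b, "the L^p norm of \sum_i Y_i is at most b": the
   sum exists when b is finite (nothing is asserted about convergence when
   b = +oo), and its L^p norm is at most b whenever it exists. *)
Definition field_sum_norm_le (disp : measure_display)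
    (T : measurableType disp) (R : realType) (P : probability T R) (d : nat)
    (Y : 'rV[int]_d -> T -> R) (p : R) (b : \bar R) : Prop :=
  (b < +oo -> exists S, is_field_sum P Y S) /\
  (forall S, is_field_sum P Y S -> 'N[P]_(p%:E)[EFin \o S] <= b).

(* Main.v *)
(** Write f as the sum over j of the layers f_j = E[f | eps_u, |u| <= j]
    - E[f | eps_u, |u| < j].

    - Revealing the coordinates of the sphere |u| = j one at a time splits f_j
      into martingale increments; resampling one coordinate bounds the L^q norm
      of the increment at u by delta_(u,q), and summing the increments gives
      |f_j|_q <= sqrt (2q + 1) (sum_(|u| = j) delta_(u,q)^2)^(1/2).
    - Shifts of f_j by lattice points in the same residue class modulo 2j + 1
      depend on disjoint sets of coordinates.  Rosenthal's inequality applied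
      to each of the (2j + 1)^d classes, and the power mean inequality across
      the classes, bound the sum of the a_i f_j(shift_i) by the j-th term.
    - Rosenthal's inequality with a constant of order p / ln p comes from the
      potential (1 + u^2)^(p/2): adding an independent centered summand
      multiplies its expectation by at most 1 + E[rosenthal_weight].

    Unbounded f is reached by truncation, which does not increase delta, and
    infinite sums by completeness of L^1 and lower semicontinuity of the L^p
    norm under L^1 convergence. *)

Require Import Defs.
From HB Require Import structures.
From mathcomp Require Import all_boot all_order all_algebra.
From mathcomp Require Import finmap ring lra zify.
From mathcomp Require Import all_classical all_reals all_analysis.
From mathcomp Require Import measurable_realfun.

Set Implicit Arguments.
Unset Strict Implicit.
Unset Printing Implicit Defensive.

Import Order.TTheory GRing.Theory Num.Theory.
Import numFieldNormedType.Exports.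

Local Open Scope classical_set_scope.
Local Open Scope ring_scope.

(** * Inequalities for real powers *)

(** Sharp constants are not pursued in either inequality: Rosenthal comes out with 12 p / ln p, the
    martingale step with sqrt (2 q + 1). The slack comes from the lattice. There are (2 j + 1)^d
    residue classes where the bound allows (4 j + 4)^d; since d >= 1 and 1 - 1/r >= 1/2, the spare
    factor 2 per coordinate is worth at least sqrt 2. With the explicit sqrt 2 this turns 14.5 into
    29, and 12 sqrt 5 <= 29 and 12 sqrt (2 p + 1) <= 29 sqrt (p - 1) close the estimate for p >= 2.

    The analysis takes place on the product space R^(Z^d) under the law of the field. There
    conditioning on a set of sites is integration of the other coordinates; stationarity and
    resampling become invariance of a product law under injective reindexing of the sites of one
    copy or of two.

    Existence of the infinite sum is settled at exponent 2 whatever p is: for square summable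
    weights the L^2 bound on finite sums makes the box sums Cauchy in L^1, and the bound at exponent
    p passes to the limit afterwards. *)

Section real_inequalities.
Context {R : realType}.
Implicit Types p q t m x y z u : R.

(** Young's inequality for t and m^(p - 1) with exponents p and p / (p - 1). This one form of
    convexity yields Bernoulli, Jensen, the power mean and the comparison of truncated powers
    below. *)
Lemma powR_tangent p t m : 1 <= p -> 0 <= t -> 0 <= m ->
  m `^ p + p * m `^ (p - 1) * (t - m) <= t `^ p.
Proof.
rewrite le_eqVlt => /predU1P[<- t0 m0|p1 t0 m0].
  by rewrite subrr powRr0 !powRr1// !mul1r addrCA subrr addr0.
have p0 : 0 < p by lra.
have pN0 : p != 0 by rewrite gt_eqF.
pose q := p / (p - 1).
have q0 : 0 < q by rewrite divr_gt0// subr_gt0.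
have pq : p^-1 + q^-1 = 1.
  by rewrite /q invf_div -{1}(div1r p) -mulrDl subrKC mulfV.
have := @conjugate_powR R t (m `^ (p - 1)) p q t0 (powR_ge0 _ _) p0 q0 pq.
rewrite -powRrM /q mulrCA divff ?mulr1; last by rewrite subr_eq0 gt_eqF.
rewrite invf_div mulrBr -!(mulrA p) [m `^ _ * m]mulrC mulr_powRB1//.
move=> h; have : p * (t * m `^ (p - 1)) <= p * (t `^ p / p + m `^ p * ((p - 1) / p)).
  by rewrite ler_wpM2l// ltW.
have -> : p * (t `^ p / p + m `^ p * ((p - 1) / p)) = t `^ p + (p - 1) * m `^ p.
  by field.
rewrite (mulrC t); lra.
Qed.

Lemma bernoulli_powR p x : 1 <= p -> -1 <= x -> 1 + p * x <= (1 + x) `^ p.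
Proof.
move=> p1 x1; have := @powR_tangent p (1 + x) 1 p1.
by rewrite !powR1 mulr1 (addrC 1 x) addrK addrC; apply; lra.
Qed.

Lemma powR_sqr x p : (x ^+ 2) `^ (p / 2) = `|x| `^ p.
Proof.
rewrite -[x ^+ 2]real_normK ?num_real// -powR_mulrn// -powRrM.
by rewrite mulrCA divff// mulr1.
Qed.

(** It is enough to find a minorant A of exp (- z) with A (1 + z + z^2) >= 1. For z <= 0 it is 1 -
    z. For 0 < z <= 1 it is (1 - z / 6)^6, six being the least n with 3 (1 - 1/n)^n >= 1, the
    requirement at z = 1. *)
Lemma expR_le_quad z : z <= 1 -> expR z <= 1 + z + z ^+ 2.
Proof.
move=> z1; have E0 : 0 < expR z by exact: expR_gt0.
suff [A [A0 AE h]] : exists A : R, [/\ 0 < A, A <= expR (- z) &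
    1 <= A * (1 + z + z ^+ 2)].
  have : expR z * expR (- z) = 1 by rewrite expRxMexpNx_1.
  have z2 : 0 < 1 + z + z ^+ 2 by nra.
  move: (expR z) E0 (expR (- z)) AE => E E0 F AF EF.
  nra.
have [z0|z0] := leP z 0.
  by exists (1 - z); split; [lra|exact: expR_ge1Dx|nra].
pose w := z / 6; have zw : z = 6 * w by rewrite /w; field.
exists ((1 - w) ^+ 6); split; first by rewrite exprn_gt0//; lra.
  have -> : - z = 6%:R * (- w) by rewrite zw mulrN.
  rewrite expRM_natl ler_pXn2r ?nnegrE ?expR_ge0//; first exact: expR_ge1Dx.
  lra.
(* The polynomial is minorised from the innermost bracket outwards on 0 <= w <= 1/6, with (1/6 -
   w)^2 >= 0 bounding w^2 below by its tangent at 1/6. *)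
have -> : (1 - w) ^+ 6 * (1 + z + z ^+ 2) = 1 + w ^+ 2 * (15 - 146 * w +
    w ^+ 2 * (435 - 636 * w + w ^+ 2 * (505 - 210 * w + 36 * w ^+ 2))).
  by rewrite zw; ring.
have w0 : 0 <= w by rewrite /w; lra.
have w6 : w <= 6^-1 by rewrite /w; lra.
have ww : w ^+ 2 <= w / 6 by rewrite expr2; nra.
have h1 : 470 <= 505 - 210 * w + 36 * w ^+ 2 by have := sqr_ge0 w; nra.
have w2 := sqr_ge0 w; have w62 : 0 <= (6^-1 - w) ^+ 2 by exact: sqr_ge0.
have h2 : 341 <= 435 - 636 * w + w ^+ 2 * (505 - 210 * w + 36 * w ^+ 2).
  apply: (@le_trans _ _ (435 - 636 * w + w ^+ 2 * 470)); last first.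
    by rewrite lerD2l ler_wpM2l.
  by move: w62; rewrite sqrrB; lra.
rewrite lerDl; apply: mulr_ge0; first exact: w2.
apply: (@le_trans _ _ (15 - 146 * w + w ^+ 2 * 341)); last first.
  by rewrite lerD2l ler_wpM2l.
by move: w62; rewrite sqrrB; lra.
Qed.

(** The bound e^z - 1 <= z e^z, used twice for z >= 0 and combined with 1 - e^z <= - z for z < 0.
    The restriction z <= 1 is lifted at the price of the factor exp |z|. *)
Lemma expR_le_quad_abs z : expR z <= 1 + z + z ^+ 2 * expR `|z|.
Proof.
have h1 : expR z - 1 <= z * expR z.
  have := expR_ge1Dx (- z); rewrite expRN; have := expR_gt0 z.
  move: (expR z) => E E0; rewrite -(@ler_pM2l _ E)// divff ?gt_eqF//; lra.
have e1 := expR_ge1Dx z.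
have [z0|z0] := leP 0 z.
  by rewrite ger0_norm//; have := ler_wpM2l z0 h1; lra.
rewrite ltr0_norm//.
have z0' : 0 <= - z by lra.
have e2 : 1 <= expR (- z) by rewrite -expR0 ler_expR.
have e3 : 1 - expR z <= - z by lra.
have := ler_wpM2l z0' e3; have := ler_wpM2l (sqr_ge0 z) e2; lra.
Qed.

(* Minkowski in L^(q/2) turns this pointwise bound into the inequality
   |a + b|_q^2 <= |a|_q^2 + (2 q + 1) |b|_q^2 for martingale increments b. *)
Lemma two_point_unit q y : 2 <= q ->
  `|1 + y| `^ q <= q * y + (1 + (2 * q + 1) * y ^+ 2) `^ (q / 2).
Proof.
move=> q2; have q1 : 1 <= q / 2 by lra.
have y2 : 0 <= y ^+ 2 by exact: sqr_ge0.
have q0 : 0 < q by lra.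
have qV : q * q^-1 = 1 by rewrite divff// gt_eqF.
(* The line is cut at -1/q and 1/q. Below -1/q one has - y <= q y^2, so passing from 1 + y^2 to 1 +
   (2 q + 1) y^2 raises the power q/2 by at least - q y. *)
have [y0|y0] := ltP y (- q^-1).
  rewrite -powR_sqr.
  have qy2 : - y <= q * y ^+ 2.
    have i0 : 0 < q^-1 by rewrite invr_gt0.
    have y1 : q * y < -1 by rewrite -(ltr_pM2l q0) mulrN qV in y0.
    have yn : 0 <= - y by lra.
    by have := ler_wpM2l yn (ltW y1); lra.
  have h1 : ((1 + y) ^+ 2) `^ (q / 2) <= (1 + y ^+ 2) `^ (q / 2).
    have ? : 0 <= q^-1 by rewrite invr_ge0; lra.
    by apply: ge0_ler_powR; rewrite ?nnegrE ?sqr_ge0//; [lra|nra|nra].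
  apply: le_trans h1 _.
  have yp : 0 <= 1 + y ^+ 2 by lra.
  have tp : 0 <= 1 + (2 * q + 1) * y ^+ 2 by nra.
  have := @powR_tangent (q / 2) _ _ q1 tp yp.
  have : 1 <= (1 + y ^+ 2) `^ (q / 2 - 1).
    by rewrite -{1}(@powRr0 _ (1 + y ^+ 2)) ler_powR//; lra.
  set A := (_ `^ (_ - 1)); set B := (_ `^ _); set C := (_ `^ _) => A1.
  have : q * - y <= q / 2 * A * (1 + (2 * q + 1) * y ^+ 2 - (1 + y ^+ 2)).
    have -> : 1 + (2 * q + 1) * y ^+ 2 - (1 + y ^+ 2) = 2 * (q * y ^+ 2) by ring.
    have -> : q / 2 * A * (2 * (q * y ^+ 2)) = q * (A * (q * y ^+ 2)) by field.
    rewrite ler_wpM2l//; first lra.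
    apply: (le_trans qy2); rewrite ler_peMl//; nra.
  lra.
(* For |q y| <= 1, (1 + y)^q <= exp (q y) <= 1 + q y + (q y)^2, and Bernoulli's inequality pays for
   the square. *)
have [y1|y1] := leP y q^-1.
  have qy : `|q * y| <= 1.
    rewrite normrM gtr0_norm; last lra.
    rewrite -(@divff _ q); last by rewrite gt_eqF//; lra.
    by rewrite ler_wpM2l ?ler_norml ?y0//; lra.
  have qi : q^-1 <= 1 by rewrite invf_le1; lra.
  have y1' : 0 <= 1 + y by lra.
  rewrite ger0_norm//.
  have h1 : (1 + y) `^ q <= expR (q * y).
    rewrite mulrC expRM ge0_ler_powR ?nnegrE ?expR_ge0 ?expR_ge1Dx//; lra.
  have h2 : expR (q * y) <= 1 + q * y + (q * y) ^+ 2.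
    by apply: expR_le_quad; rewrite ler_norml in qy; case/andP: qy.
  have h3 := @bernoulli_powR (q / 2) ((2 * q + 1) * y ^+ 2) q1.
  have : -1 <= (2 * q + 1) * y ^+ 2 by nra.
  move/h3; set B := (_ `^ (q / 2)) => {}h3.
  apply: (le_trans h1); apply: (le_trans h2); nra.
(* Above 1/q the linear term is at most q y^2, so (1 + y)^2 <= 1 + (2 q + 1) y^2; the coefficient 2
   q + 1 originates here. *)
have qy2 : y <= q * y ^+ 2.
  have i0 : 0 < q^-1 by rewrite invr_gt0.
  have y1' : 1 < q * y by rewrite -(ltr_pM2l q0) qV in y1.
  have yn : 0 <= y by lra.
  by have := ler_wpM2l yn (ltW y1'); lra.
have qi : 0 <= q^-1 by rewrite invr_ge0; lra.
have yp : 0 <= y by lra.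
rewrite -powR_sqr; apply: (@le_trans _ _ ((1 + (2 * q + 1) * y ^+ 2) `^ (q / 2))).
  by apply: ge0_ler_powR; rewrite ?nnegrE; nra.
by rewrite lerDr; nra.
Qed.

(** The homogeneous form. The factor q a |a|^(q - 2) is the derivative of |a|^q; its product with b
    integrates to zero when b is a martingale increment over a. *)
Lemma two_point q (a b : R) : 2 <= q ->
  `|a + b| `^ q <= q * (a * `|a| `^ (q - 2)) * b +
    (a ^+ 2 + (2 * q + 1) * b ^+ 2) `^ (q / 2).
Proof.
move=> q2; have [->|a0] := eqVneq a 0.
  rewrite add0r mul0r mulr0 mul0r add0r expr0n/= add0r.
  rewrite -powR_sqr ge0_ler_powR ?nnegrE ?sqr_ge0//; first lra.
    by have := sqr_ge0 b; nra.
  by have := sqr_ge0 b; nra.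
have ab : a + b = a * (1 + b / a) by field.
have na : 0 < `|a| by rewrite normr_gt0.
have -> : a ^+ 2 + (2 * q + 1) * b ^+ 2 =
    a ^+ 2 * (1 + (2 * q + 1) * (b / a) ^+ 2) by field.
have r0 : 0 <= 1 + (2 * q + 1) * (b / a) ^+ 2.
  by have := sqr_ge0 (b / a); nra.
rewrite ab normrM (powRM _ (normr_ge0 _) (normr_ge0 _)) (powRM _ (sqr_ge0 _) r0).
rewrite powR_sqr.
have -> : q * (a * `|a| `^ (q - 2)) * b = `|a| `^ q * (q * (b / a)).
  have -> : `|a| `^ q = `|a| `^ (q - 2) * a ^+ 2.
    rewrite -(real_normK (num_real a)) -(powR_mulrn 2)// -powRD.
      by congr (_ `^ _); ring.
    by rewrite (gt_eqF na) implybT.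
  by field.
rewrite -mulrDr ler_wpM2l ?powR_ge0//; exact: two_point_unit.
Qed.

(** The p-th power of the Japanese bracket sqrt (1 + u^2). The added 1 keeps the logarithmic
    derivative p u / (1 + u^2) bounded, which lets a new summand act through a multiplicative
    factor. *)
Definition japanese p u := (1 + u ^+ 2) `^ (p / 2).

Lemma le_japanese p u : 0 <= p -> `|u| `^ p <= japanese p u.
Proof.
move=> p0; rewrite -powR_sqr ge0_ler_powR ?nnegrE ?sqr_ge0//; first lra.
  by have := sqr_ge0 u; lra.
lra.
Qed.

Lemma ln_le_half x : 0 < x -> ln x <= x / 2.
Proof.
move=> x0; have -> : x = 2 * (1 + (x / 2 - 1)) by field.
rewrite lnM ?posrE; [|lra|lra].
have := @le_ln1Dx R (x / 2 - 1); have := @le_ln1Dx R 1; lra.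
Qed.

(** The two terms pay for increments below and above |x| = ln p / (2 p). The first collects p^2 from
    a square and p^(1/2) from an exponential remainder; the second is a pure p-th power, doubled so
    as to absorb the linear term as well. *)
Definition rosenthal_weight p x :=
  p `^ (5 / 2) * x ^+ 2 + 2 * (3 * p / ln p) `^ p * `|x| `^ p.

(** The potential is multiplied by (1 + w)^(p/2) with w = (2 u x + x^2) / (1 + u^2). The term linear
    in x is kept exactly, because it averages to zero over a centered x independent of u; the rest
    is bounded by a weight in x alone. *)
Lemma japanese_step p u x : 2 <= p ->
  japanese p (u + x) <=
  japanese p u * (1 + p * (u / (1 + u ^+ 2)) * x + rosenthal_weight p x).
Proof.
move=> p2; have L0 : 0 < ln p by rewrite ln_gt0//; lra.
have Lp : ln p <= p / 2 by apply: ln_le_half; lra.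
have u2 : 0 <= u ^+ 2 by exact: sqr_ge0.
have x2 : 0 <= x ^+ 2 by exact: sqr_ge0.
have r0 : 0 < 1 + u ^+ 2 by lra.
pose w := (2 * u * x + x ^+ 2) / (1 + u ^+ 2).
have w1 : 0 <= 1 + w.
  have -> : 1 + w = (1 + (u + x) ^+ 2) / (1 + u ^+ 2).
    by rewrite /w; field; rewrite gt_eqF.
  by rewrite divr_ge0//; [have := sqr_ge0 (u + x)|]; lra.
have -> : japanese p (u + x) = japanese p u * (1 + w) `^ (p / 2).
  rewrite -powRM//; last lra.
  by congr (_ `^ _); rewrite /w; field; rewrite gt_eqF.
rewrite ler_wpM2l ?powR_ge0//.
have c1 : `|u / (1 + u ^+ 2)| <= 2^-1.
  rewrite normrM normfV (gtr0_norm r0) ler_pdivrMr//.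
  by rewrite -(real_normK (num_real u)); have := sqr_ge0 (`|u| - 1); nra.
set c := u / (1 + u ^+ 2) in c1 *.
have wE : w = 2 * c * x + x ^+ 2 / (1 + u ^+ 2).
  by rewrite /w /c; field; rewrite gt_eqF.
have wx : 0 <= x ^+ 2 / (1 + u ^+ 2) <= x ^+ 2.
  apply/andP; split; first by apply: divr_ge0 => //; exact: ltW.
  by rewrite ler_pdivrMr// mulrDr mulr1 lerDl mulr_ge0.
have cx : `|c * x| <= `|x| / 2.
  by rewrite normrM mulrC ler_wpM2l.
(* Small increment: |(p/2) w| <= (3/8) ln p, so the exponential remainder costs at most p^(1/2). *)
have [xs|xl] := leP `|x| (ln p / (2 * p)).
  have px : p * `|x| <= ln p / 2.
    rewrite -(@ler_pM2l _ p) in xs; last lra.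
    by apply: (le_trans xs); rewrite le_eqVlt; apply/orP; left; apply/eqP; field; lra.
  have xh : `|x| <= 2^-1.
    by rewrite -(@ler_pM2l _ p); lra.
  have xx : x ^+ 2 <= `|x| / 2.
    by rewrite -(real_normK (num_real x)); have := normr_ge0 x; nra.
  pose z := p / 2 * w.
  have zx : `|z| <= 3 / 4 * (p * `|x|).
    rewrite /z normrM gtr0_norm; last lra.
    have -> : 3 / 4 * (p * `|x|) = p / 2 * (3 / 2 * `|x|) by field.
    rewrite ler_wpM2l//; first lra.
    rewrite wE (le_trans (ler_normD _ _))// -mulrA normrM.
    rewrite (gtr0_norm (_ : 0 < 2))// (ger0_norm (_ : 0 <= _ / _)); lra.
  have h1 : (1 + w) `^ (p / 2) <= expR z.
    have -> : expR z = expR w `^ (p / 2) by rewrite -expRM mulrC.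
    by rewrite ge0_ler_powR ?nnegrE ?expR_ge0 ?expR_ge1Dx//; lra.
  have h2 : expR `|z| <= p `^ 2^-1.
    rewrite -{1}(@lnK _ p) ?posrE//; last lra.
    by rewrite -expRM ler_expR; have := normr_ge0 x; lra.
  have h3 : z ^+ 2 <= 9 / 16 * (p ^+ 2 * x ^+ 2).
    rewrite -(real_normK (num_real z)) -[x ^+ 2](real_normK (num_real x)).
    have -> : 9 / 16 * (p ^+ 2 * `|x| ^+ 2) = (3 / 4 * (p * `|x|)) ^+ 2 by field.
    by rewrite ler_pXn2r ?nnegrE//; have := normr_ge0 x; nra.
  have h4 : p `^ (5 / 2) = p ^+ 2 * p `^ 2^-1.
    rewrite -powR_mulrn; last lra.
    rewrite -powRD; first by congr (_ `^ _); field.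
    by rewrite (gt_eqF (_ : 0 < p)) ?implybT//; lra.
  have h5 : 1 <= p `^ 2^-1.
    by rewrite -{1}(@powRr0 _ p) ler_powR//; lra.
  have h6 : 0 <= 2 * (3 * p / ln p) `^ p * `|x| `^ p.
    by rewrite !mulr_ge0 ?powR_ge0.
  rewrite /rosenthal_weight h4.
  apply: (le_trans h1); apply: (le_trans (expR_le_quad_abs z)).
  (* The share 9/16 from z^2 and the share 7/16 from the quadratic part of z add up to the
     coefficient p^(5/2). *)
  have h7 : z ^+ 2 * expR `|z| <= 9 / 16 * (p ^+ 2 * x ^+ 2) * p `^ 2^-1.
    by rewrite ler_pM ?sqr_ge0 ?expR_ge0.
  have h8 : z <= p * c * x + p / 2 * x ^+ 2.
    rewrite /z wE; nra.
  have h9 : p / 2 * x ^+ 2 <= 7 / 16 * (p ^+ 2 * x ^+ 2) * p `^ 2^-1.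
    rewrite -[leLHS]mulr1 ler_pM//; nra.
  lra.
(* Large increment: both 1 <= 2 (p / ln p) |x| and |x| <= (p / ln p) |x|, whence 1 + |x| <= 3 (p /
   ln p) |x|. A second copy of the p-th power compensates a negative linear term. *)
have x0 : 0 < `|x| by apply: le_lt_trans xl; rewrite divr_ge0//; lra.
have h1 : (1 + w) `^ (p / 2) <= (1 + `|x|) `^ p.
  rewrite -(@ger0_norm _ (1 + `|x|)); last lra.
  rewrite -powR_sqr ge0_ler_powR ?nnegrE ?sqr_ge0//; first lra.
  have -> : (1 + `|x|) ^+ 2 = 1 + 2 * `|x| + x ^+ 2.
    by rewrite -[x ^+ 2]real_normK ?num_real//; ring.
  by rewrite ler_norml in cx; rewrite wE; lra.
have h2 : p * `|x| <= (1 + `|x|) `^ p.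
  by apply: le_trans (@bernoulli_powR p `|x| _ _); lra.
have h3 : (1 + `|x|) `^ p <= (3 * p / ln p) `^ p * `|x| `^ p.
  have c0 : 0 <= 3 * p / ln p by rewrite divr_ge0//; lra.
  rewrite -(powRM _ c0 (normr_ge0 x)); apply: ge0_ler_powR.
  - lra.
  - by rewrite nnegrE; lra.
  - by rewrite nnegrE mulr_ge0.
  have e1 : 1 <= 2 * p / ln p * `|x|.
    rewrite ltr_pdivrMr in xl; last lra.
    rewrite mulrAC ler_pdivlMr//; lra.
  have e2 : 1 <= p / ln p by rewrite ler_pdivlMr//; lra.
  have -> : 3 * p / ln p * `|x| = 2 * p / ln p * `|x| + p / ln p * `|x| by ring.
  by rewrite lerD// ler_peMl.
have h4 : 0 <= p `^ (5 / 2) * x ^+ 2 by rewrite mulr_ge0 ?powR_ge0.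
rewrite /rosenthal_weight.
have h5 : - (p * `|x|) <= p * (c * x).
  by rewrite -mulrN ler_wpM2l//; [lra|rewrite ler_norml in cx; lra].
lra.
Qed.

End real_inequalities.

(** * Expectations of bounded functions *)

(** The working class of the core estimates: closed under the operations used, with real-valued
    integrals and with Fubini available at no further cost. *)
Definition bounded_measurable d (T : measurableType d) (R : realType)
    (g : T -> R) : Prop :=
  measurable_fun [set: T] g /\ exists M, forall x, `|g x| <= M.

Section bounded_measurable_closure.
Context d (T : measurableType d) (R : realType).
Implicit Types (f g : T -> R).
Local Notation bm := (@bounded_measurable d T R).

Lemma bm_cst (c : R) : bm (cst c).
Proof. by split=> //; exists `|c|. Qed.

Lemma bmD f g : bm f -> bm g -> bm (fun x => f x + g x).
Proof.
move=> [mf [M fM]] [mg [N gN]]; split; first exact: measurable_funD.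
by exists (M + N) => x; rewrite (le_trans (ler_normD _ _))// lerD.
Qed.

Lemma bmM f g : bm f -> bm g -> bm (fun x => f x * g x).
Proof.
move=> [mf [M fM]] [mg [N gN]]; split; first exact: measurable_funM.
by exists (M * N) => x; rewrite normrM ler_pM.
Qed.

Lemma bmZ (c : R) f : bm f -> bm (fun x => c * f x).
Proof. exact: bmM (bm_cst c). Qed.

Lemma bmB f g : bm f -> bm g -> bm (fun x => f x - g x).
Proof.
move=> [mf [M fM]] [mg [N gN]]; split; first exact: measurable_funB.
by exists (M + N) => x; rewrite (le_trans (ler_normB _ _))// lerD.
Qed.

Lemma bm_sum (J : Type) (s : seq J) (F : J -> T -> R) :
  (forall j, bm (F j)) -> bm (fun x => \sum_(j <- s) F j x).
Proof.
move=> bF; elim: s => [|j s IH].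
  by under eq_fun do rewrite big_nil; exact: bm_cst.
by under eq_fun do rewrite big_cons; exact: bmD.
Qed.

Lemma bm_norm f : bm f -> bm (fun x => `|f x|).
Proof.
move=> [mf [M fM]]; split; first exact: measurableT_comp.
by exists M => x; rewrite normr_id.
Qed.

Lemma bmX f n : bm f -> bm (fun x => f x ^+ n).
Proof.
move=> bf; elim: n => [|n IH].
  by under eq_fun do rewrite expr0; exact: bm_cst.
by under eq_fun do rewrite exprS; exact: bmM.
Qed.

Lemma bm_powR f p : 0 <= p -> (forall x, 0 <= f x) -> bm f ->
  bm (fun x => f x `^ p).
Proof.
move=> p0 f0 [mf [M fM]]; split.
  exact: (measurableT_comp (measurable_powR _)).
exists (M `^ p) => x; rewrite ger0_norm ?powR_ge0// ge0_ler_powR ?nnegrE//.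
- by rewrite (le_trans _ (fM x)).
- by rewrite -(ger0_norm (f0 x)).
Qed.

Lemma bm_norm_powR f p : 0 <= p -> bm f -> bm (fun x => `|f x| `^ p).
Proof. by move=> p0 bf; apply: bm_powR => //; exact: bm_norm. Qed.

End bounded_measurable_closure.

Lemma bm_comp d d' (T : measurableType d) (T' : measurableType d')
    (R : realType) (g : T' -> R) (phi : T -> T') :
  measurable_fun [set: T] phi -> bounded_measurable g ->
  bounded_measurable (fun x => g (phi x)).
Proof.
move=> mphi [mg [M gM]]; split; first exact: measurableT_comp.
by exists M.
Qed.

Section expectation.
Context d (T : measurableType d) (R : realType) (P : probability T R).
Implicit Types (f g : T -> R).
Local Notation bm := (@bounded_measurable d T R).

Lemma bm_integrable f : bm f -> P.-integrable setT (EFin \o f).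
Proof.
move=> [mf [M fM]]; apply: measurable_bounded_integrable => //.
  by rewrite -ge0_fin_numE ?fin_num_measure.
exists M; split; first exact: num_real.
by move=> r Mr x _; rewrite /= (le_trans (fM x))// ltW.
Qed.

Lemma integral_EFin f : bm f -> (\int[P]_x (f x)%:E)%E = (\int[P]_x f x)%:E.
Proof. by move=> bf; rewrite /Rintegral fineK// integrable_fin_num//; exact: bm_integrable. Qed.

Lemma EbmD f g : bm f -> bm g ->
  \int[P]_x (f x + g x) = \int[P]_x f x + \int[P]_x g x.
Proof. by move=> bf bg; rewrite RintegralD//; exact: bm_integrable. Qed.

Lemma EbmB f g : bm f -> bm g ->
  \int[P]_x (f x - g x) = \int[P]_x f x - \int[P]_x g x.
Proof. by move=> bf bg; rewrite RintegralB//; exact: bm_integrable. Qed.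

Lemma EbmZ (c : R) f : bm f -> \int[P]_x (c * f x) = c * \int[P]_x f x.
Proof. by move=> bf; rewrite RintegralZl//; exact: bm_integrable. Qed.

Lemma Ebm_cst (c : R) : \int[P]_x c = c.
Proof. by rewrite Rintegral_cst// [X in fine X]probability_setT mulr1. Qed.

Lemma Ebm_le f g : bm f -> bm g -> (forall x, f x <= g x) ->
  \int[P]_x f x <= \int[P]_x g x.
Proof. by move=> bf bg fg; apply: le_Rintegral => //; exact: bm_integrable. Qed.

Lemma Ebm_ge0 f : (forall x, 0 <= f x) -> 0 <= \int[P]_x f x.
Proof. by move=> f0; exact: Rintegral_ge0. Qed.

(** The tangent to t^p at the mean of |f|, integrated. *)
Lemma jensen_powR f p : 1 <= p -> bm f ->
  `|\int[P]_x f x| `^ p <= \int[P]_x (`|f x| `^ p).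
Proof.
move=> p1 bf; have p0 : 0 <= p by lra.
have bn := bm_norm bf; have bp := bm_norm_powR p0 bf.
set m := \int[P]_x `|f x|.
have m0 : 0 <= m by exact: Ebm_ge0.
apply: (@le_trans _ _ (m `^ p)).
  rewrite ge0_ler_powR ?nnegrE//; apply: le_normr_Rintegral => //.
  exact: bm_integrable.
have h x : m `^ p + p * m `^ (p - 1) * (`|f x| - m) <= `|f x| `^ p.
  exact: powR_tangent.
have b1 : bm (fun x => `|f x| - m) by apply: bmB => //; exact: bm_cst.
apply: le_trans (Ebm_le _ bp h); last first.
  by apply: bmD; [exact: bm_cst|exact: bmZ].
rewrite EbmD; [|exact: bm_cst|exact: bmZ].
by rewrite Ebm_cst EbmZ// EbmB//; [rewrite Ebm_cst subrr mulr0 addr0|exact: bm_cst].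
Qed.

End expectation.

Section fubini.
Context d1 d2 (T1 : measurableType d1) (T2 : measurableType d2) (R : realType).
Variables (P1 : probability T1 R) (P2 : probability T2 R).
Variable f : T1 * T2 -> R.
Hypothesis bf : bounded_measurable f.

Lemma bm_section x : bounded_measurable (fun y => f (x, y)).
Proof. exact: (bm_comp (measurable_pair1 x)). Qed.

Let integrable_f : (P1 \x P2)%E.-integrable setT (EFin \o f).
Proof. exact: (@bm_integrable _ _ _ (P1 \x P2)%E). Qed.

Lemma bm_partial : bounded_measurable (fun x => \int[P2]_y f (x, y)).
Proof.
have [mf [M fM]] := bf; split.
  have := measurable_fubini_F integrable_f.
  move=> /(measurableT_comp (@fine_measurable R _ measurableT)); apply.
exists M => x; apply: (@le_trans _ _ (\int[P2]_y `|f (x, y)|)).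
  by apply: le_normr_Rintegral => //; apply: bm_integrable; exact: bm_section.
rewrite -[leRHS](Ebm_cst P2); apply: Ebm_le => //.
  by apply: bm_norm; exact: bm_section.
exact: bm_cst.
Qed.

Lemma Ebm_fubini :
  \int[P1]_x (\int[P2]_y f (x, y)) = \int[(P1 \x P2)%E]_z f z.
Proof.
rewrite /Rintegral -(integral12_prod_meas1 integrable_f).
congr fine; apply: eq_integral => x _.
by rewrite -[in LHS]/(Rintegral _ _ _) -integral_EFin//; exact: bm_section.
Qed.

End fubini.

HB.lock Definition norm_p d (T : measurableType d) (R : realType)
  (P : probability T R) (q : R) (f : T -> R) : R :=
  (\int[P]_x (`|f x| `^ q)) `^ q^-1.
Canonical locked_norm_p := Unlockable norm_p.unlock.

Section norms.
Context d (T : measurableType d) (R : realType) (P : probability T R).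
Implicit Types (f g : T -> R).
Local Notation bm := (@bounded_measurable d T R).

Local Notation norm_p := (norm_p P).

Lemma norm_p_ge0 q f : 0 <= norm_p q f. Proof. by rewrite unlock powR_ge0. Qed.

Lemma Lnorm_norm_p q f : 0 <= q -> bm f ->
  ('N[P]_(q%:E)[EFin \o f])%E = (norm_p q f)%:E.
Proof.
move=> q0 bf; rewrite Lnorm.unlock norm_p.unlock /= -poweR_EFin; congr poweR.
under eq_integral do rewrite -poweR_EFin.
by rewrite -integral_EFin//; exact: bm_norm_powR.
Qed.

Lemma norm_p_powR q f : 0 < q -> norm_p q f `^ q = \int[P]_x (`|f x| `^ q).
Proof.
move=> q0; rewrite unlock -powRrM mulVf ?gt_eqF// powRr1//; apply: Ebm_ge0 => x.
exact: powR_ge0.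
Qed.

Lemma norm_p_D q f g : 1 <= q -> bm f -> bm g ->
  norm_p q (fun x => f x + g x) <= norm_p q f + norm_p q g.
Proof.
move=> q1 bf bg; have q0 : 0 <= q by lra.
rewrite -lee_fin EFinD -(Lnorm_norm_p q0 (bmD bf bg)) -(Lnorm_norm_p q0 bf).
rewrite -(Lnorm_norm_p q0 bg).
exact: (minkowski_EFin P (proj1 bf) (proj1 bg) q1).
Qed.

Lemma norm_pZ q (c : R) f : 0 < q -> bm f ->
  norm_p q (fun x => c * f x) = `|c| * norm_p q f.
Proof.
move=> q0 bf; rewrite unlock.
under eq_Rintegral do rewrite normrM powRM//.
rewrite EbmZ; last by apply: bm_norm_powR => //; exact: ltW.
rewrite powRM ?powR_ge0//; last by apply: Ebm_ge0 => x; exact: powR_ge0.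
by rewrite -powRrM mulfV ?gt_eqF// powRr1.
Qed.

Lemma norm_p_sum (J : Type) q (s : seq J) (F : J -> T -> R) : 1 <= q ->
  (forall j, bm (F j)) ->
  norm_p q (fun x => \sum_(j <- s) F j x) <= \sum_(j <- s) norm_p q (F j).
Proof.
move=> q1 bF; have q0 : q != 0 by rewrite gt_eqF//; lra.
elim: s => [|j s IH].
  rewrite big_nil unlock.
  under eq_Rintegral do rewrite big_nil normr0 powR0//.
  by rewrite Ebm_cst powR0// invr_eq0.
rewrite big_cons; under [X in norm_p q X]eq_fun do rewrite big_cons.
apply: le_trans (norm_p_D _ _ _) _ => //; first exact: bm_sum.
by rewrite lerD2l.
Qed.

Lemma le_norm_p q f c : 0 < q -> 0 <= c ->
  \int[P]_x (`|f x| `^ q) <= c `^ q -> norm_p q f <= c.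
Proof.
move=> q0 c0 h; rewrite unlock -[leRHS](powRr1 c0) -(@mulfV _ q) ?gt_eqF// powRrM.
rewrite ge0_ler_powR ?nnegrE ?invr_ge0 ?powR_ge0//; first exact: ltW.
by apply: Ebm_ge0 => x; exact: powR_ge0.
Qed.

End norms.

Lemma Ebm_pushforward d d' (T : measurableType d) (T' : measurableType d')
    (R : realType) (P : probability T R) (Q : probability T' R)
    (phi : T -> T') (g : T' -> R) :
  measurable_fun [set: T] phi ->
  (forall A, measurable A -> P (phi @^-1` A) = Q A) ->
  bounded_measurable g ->
  \int[P]_x g (phi x) = \int[Q]_y g y.
Proof.
move=> mphi PQ bg; rewrite /Rintegral; congr fine.
have QP A : measurable A -> A `<=` [set: T'] -> Q A = pushforward P phi A.
  by move=> mA _; rewrite /pushforward PQ.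
have mg : measurable_fun [set: T'] (EFin \o g).
  by apply/measurable_EFinP; case: bg.
rewrite (eq_measure_integral (pushforward P phi) QP) integral_pushforward//.
by rewrite preimage_setT; exact: (bm_integrable P (bm_comp mphi bg)).
Qed.

Lemma norm_p_pushforward d d' (T : measurableType d) (T' : measurableType d')
    (R : realType) (P : probability T R) (Q : probability T' R)
    (phi : T -> T') (g : T' -> R) (q : R) : 0 <= q ->
  measurable_fun [set: T] phi ->
  (forall A, measurable A -> P (phi @^-1` A) = Q A) ->
  bounded_measurable g ->
  norm_p P q (fun x => g (phi x)) = norm_p Q q g.
Proof.
move=> q0 mphi PQ bg; rewrite unlock; congr powR.
by rewrite -(Ebm_pushforward mphi PQ)//; exact: bm_norm_powR.
Qed.

(** * I.i.d. laws on product spaces *)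

Definition cylinder (R : realType) (K : choiceType) (J : {fset K})
    (B : K -> set R) : set (product_space R K) :=
  [set x | forall k, k \in J -> B k (x k)].

Definition cylinders (R : realType) (K : choiceType)
    : set_system (product_space R K) :=
  [set A | exists (J : {fset K}) (B : K -> set R),
     (forall k, measurable (B k)) /\ A = cylinder J B].

(** The product law of mu is characterised by its values on cylinders instead of being constructed:
    the instances come from the given field and from products of its law. A bare set function
    suffices for mu, since only its values enter. *)
Definition iid_law (R : realType) (K : choiceType) (mu : set R -> \bar R)
    (nu : set (product_space R K) -> \bar R) : Prop :=
  forall (J : {fset K}) (B : K -> set R), (forall k, measurable (B k)) ->
    nu (cylinder J B) = (\prod_(k <- J) mu (B k))%E.

Section product_space_measurability.
Context {R : realType} {K : choiceType}.
Local Notation E := (product_space R K).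

Lemma measurable_coord (k : K) : measurable_fun [set: E] (fun x : E => x k).
Proof.
move=> _ B mB; rewrite setTI; apply: sub_sigma_algebra.
by exists k, B.
Qed.

Lemma measurable_to_product d (T : measurableType d) (g : T -> E) :
  (forall k, measurable_fun [set: T] (fun w => g w k)) ->
  measurable_fun [set: T] g.
Proof.
move=> mg; apply: (@measurability _ _ _ E _ _ (@coordinate_sets R K)) => //.
move=> _ [C [k [B [mB ->]]] <-].
exact: mg.
Qed.

Lemma measurable_cylinder (J : {fset K}) (B : K -> set R) :
  (forall k, measurable (B k)) -> measurable (cylinder J B).
Proof.
move=> mB; rewrite (_ : cylinder J B =
    \bigcap_(k in [set` J]) ((fun x : E => x k) @^-1` B k)); last first.
  by apply/seteqP; split=> x Jx k kJ; exact: Jx.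
apply: fin_bigcap_measurable => [|k _]; first exact: finite_fset.
by rewrite -[X in measurable X]setTI; exact: measurable_coord.
Qed.

Lemma cylinders_setI : setI_closed (@cylinders R K).
Proof.
move=> _ _ [J [B [mB ->]]] [J' [B' [mB' ->]]].
pose C k := (if k \in J then B k else setT) `&` (if k \in J' then B' k else setT).
exists (J `|` J')%fset, C; split=> [k|].
  by apply: measurableI; case: ifP.
apply/seteqP; split=> x /=.
  move=> [xJ xJ'] k _; rewrite /C; split.
    by case: ifPn => // kJ; exact: xJ.
  by case: ifPn => // kJ; exact: xJ'.
move=> h; split=> k kJ; have := h k; rewrite inE kJ ?orbT => /(_ isT).
  by rewrite /C kJ => -[].
by rewrite /C kJ => -[].
Qed.

Lemma measurable_product_cylinders :
  @measurable _ E = <<s @cylinders R K >>.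
Proof.
apply/seteqP; split.
  apply: smallest_sub; first exact: smallest_sigma_algebra.
  move=> _ [k [B [mB ->]]]; apply: sub_sigma_algebra.
  exists [fset k]%fset, (fun=> B); split=> //; apply/seteqP; split=> x /=.
    by move=> Bx k'; rewrite inE => /eqP ->.
  by apply; rewrite inE.
apply: smallest_sub; first exact: sigma_algebra_measurable.
by move=> _ [J [B [mB ->]]]; exact: measurable_cylinder.
Qed.

Lemma product_probability_unique (nu1 nu2 : probability E R) :
  (forall J B, (forall k, measurable (B k)) ->
     nu1 (cylinder J B) = nu2 (cylinder J B)) ->
  forall A, measurable A -> nu1 A = nu2 A.
Proof.
move=> h A mA.
apply: (@measure_unique _ R E (@cylinders R K) (fun=> setT)) => //.
- exact: measurable_product_cylinders.
- exact: cylinders_setI.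
- move=> _; exists fset0, (fun=> setT); split=> //.
  by apply/seteqP; split.
- by rewrite bigcup_const.
- by move=> _ [J [B [mB ->]]]; exact: h.
- by move=> _; rewrite -ge0_fin_numE ?fin_num_measure.
Qed.

End product_space_measurability.

Section pushforward_probability.
Context d d' (T : measurableType d) (T' : measurableType d') (R : realType).
Variables (P : probability T R) (phi : T -> T').
Hypothesis mphi : measurable_fun [set: T] phi.

Definition push_prob : probability T' R :=
  distribution P (HB.pack_for {mfun T >-> T'} phi
    (isMeasurableFun.Build _ _ _ _ _ mphi)).

Lemma push_probE A : push_prob A = P (phi @^-1` A).
Proof. by []. Qed.

End pushforward_probability.

Definition reindex (R : realType) (K K' : Type) (s : K -> K')
  (z : product_space R K') : product_space R K := fun k => z (s k).

Lemma measurable_reindex (R : realType) (K K' : choiceType) (s : K -> K') :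
  measurable_fun [set: product_space R K'] (@reindex R K K' s).
Proof. by apply: measurable_to_product => k; exact: measurable_coord. Qed.

(** The single source of all invariances below: shifts, merging two copies and swapping coordinates
    are injective maps of index sets. Injectivity keeps distinct coordinates distinct, so a cylinder
    pulls back to a cylinder with the same factors. *)
Lemma iid_reindex (R : realType) (K K' : choiceType) (s : K -> K')
    (mu : set R -> \bar R) (nu : probability (product_space R K) R)
    (nu' : probability (product_space R K') R) :
  injective s -> iid_law mu nu -> iid_law mu nu' ->
  forall A, measurable A -> nu' (reindex s @^-1` A) = nu A.
Proof.
move=> injs inu inu' A mA.
pose ms := @measurable_reindex R K K' s.
rewrite -(push_probE nu' ms).
apply: (product_probability_unique _ mA) => J B mB.
rewrite push_probE inu//.
have [J0|[k0 k0J]] := fset_0Vmem J.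
  rewrite J0 big_seq_fset0.
  rewrite (_ : _ @^-1` _ = cylinder (fset0 : {fset K'}) (fun=> setT)); last first.
    by apply/seteqP; split.
  by rewrite inu'// big_seq_fset0.
(* A left inverse of [s] on J, with the default [k0] off the image; this default is why the empty J
   is treated apart. *)
pose r k' := if pselect (exists2 k, k \in J & s k = k') is left h
             then s2val (cid2 h) else k0.
have rK k : k \in J -> r (s k) = k.
  move=> kJ; rewrite /r; case: pselect => [h|[]]; last by exists k.
  by case: (cid2 h) => /= k1 _ /injs.
rewrite (_ : _ @^-1` _ = cylinder [fset s k | k in J]%fset (B \o r)); last first.
  apply/seteqP; split=> z /= h.
    by move=> _ /imfsetP[k /= kJ ->]; rewrite rK//; exact: h.
  by move=> k kJ; have := h (s k); rewrite /= rK//; apply; exact: in_imfset.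
rewrite inu'; last by move=> k; exact: mB.
rewrite big_imfset/=; last by move=> ? ? _ _; exact: injs.
by rewrite big_seq [RHS]big_seq; apply: eq_bigr => k kJ; rewrite /= rK.
Qed.

(** * Two independent copies as one field *)

Section pairs.
Context {R : realType} {I : choiceType}.
Local Notation E := (product_space R I).
Local Notation EE := (product_space R (I + I)%type).

(** Indexing both copies by I + I turns every exchange of coordinates between them into a reindexing
    of a single i.i.d. field. *)
Definition join (z : E * E) : EE :=
  fun k => match k with inl i => z.1 i | inr i => z.2 i end.

Definition split_pair (z : EE) : E * E := (reindex inl z, reindex inr z).

Lemma split_join z : split_pair (join z) = z.
Proof. by case: z. Qed.

Lemma measurable_join : measurable_fun [set: E * E] join.
Proof.
apply: measurable_to_product => -[i|i].
  exact: (measurableT_comp (measurable_coord i) measurable_fst).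
exact: (measurableT_comp (measurable_coord i) measurable_snd).
Qed.

Lemma measurable_split : measurable_fun [set: EE] split_pair.
Proof.
by apply: measurable_fun_pair; exact: measurable_reindex.
Qed.

Variables (mu : set R -> \bar R) (nu : probability E R).
Hypothesis inu : iid_law mu nu.

Lemma iid_join : iid_law mu (push_prob (nu \x nu)%E measurable_join).
Proof.
move=> J B mB; rewrite push_probE.
pose getl (k : I + I) := if k is inl i then Some i else None.
pose getr (k : I + I) := if k is inr i then Some i else None.
pose Jl := [fset i in pmap getl J]%fset.
pose Jr := [fset i in pmap getr J]%fset.
have getlK : ocancel getl inl by case.
have getrK : ocancel getr inr by case.
have inJl i : (i \in Jl) = (inl i \in J).
  by rewrite !inE /= mem_pmap; apply/mapP/idP => [[[j|//] jJ [->]]//|iJ]; exists (inl i).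
have inJr i : (i \in Jr) = (inr i \in J).
  by rewrite !inE /= mem_pmap; apply/mapP/idP => [[[//|j] jJ [->]]//|iJ]; exists (inr i).
rewrite (_ : _ @^-1` _ =
    cylinder Jl (B \o inl) `*` cylinder Jr (B \o inr)); last first.
  apply/seteqP; split=> -[x y] /= h.
    split=> i; rewrite ?inJl ?inJr => iJ; first exact: (h (inl i)).
    exact: (h (inr i)).
  case: h => hl hr [i|i] iJ; first by apply: hl; rewrite inJl.
  by apply: hr; rewrite inJr.
transitivity (nu (cylinder Jl (B \o inl)) * nu (cylinder Jr (B \o inr)))%E.
  by apply: product_measure1E; apply: measurable_cylinder => k; exact: mB.
rewrite inu; last by move=> k; exact: mB.
rewrite inu; last by move=> k; exact: mB.
have permE (J' : {fset I}) (l : seq I) (F : I -> \bar R) : uniq l ->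
    J' =i l -> (\prod_(i <- J') F i = \prod_(i <- l) F i)%E.
  by move=> ul Jl'; apply: perm_big; apply: uniq_perm.
rewrite (permE Jl (pmap getl J)); [|exact/(pmap_uniq getlK)/fset_uniq|]; last first.
  by move=> i; rewrite inE.
rewrite (permE Jr (pmap getr J)); [|exact/(pmap_uniq getrK)/fset_uniq|]; last first.
  by move=> i; rewrite inE.
elim: (enum_fset J) => [|[i|i] s IH]; first by rewrite !big_nil mule1.
  by rewrite /= !big_cons -muleA IH.
by rewrite /= !big_cons muleCA IH.
Qed.

Lemma join_preserve (s : I -> (I + I)%type) : injective s ->
  forall A, measurable A ->
    (nu \x nu)%E ((fun z => reindex s (join z)) @^-1` A) = nu A.
Proof.
move=> injs A mA; rewrite -(iid_reindex injs inu iid_join mA).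
by rewrite push_probE.
Qed.

Lemma join_preserve2 (s : (I + I)%type -> (I + I)%type) : injective s ->
  forall A, measurable A ->
    (nu \x nu)%E ((fun z => split_pair (reindex s (join z))) @^-1` A) =
    (nu \x nu)%E A.
Proof.
move=> injs A mA.
have mA' : measurable (split_pair @^-1` A).
  by rewrite -[X in measurable X]setTI; exact: measurable_split.
have := iid_reindex injs iid_join iid_join mA'.
rewrite !push_probE !comp_preimage => ->; congr (_ _).
by apply/seteqP; split=> z /=; rewrite split_join.
Qed.

End pairs.

(** * Martingale increments and resampling *)

Section martingale_step.
Context d (T : measurableType d) (R : realType) (P : probability T R).
Implicit Types (a b : T -> R).
Local Notation bm := (@bounded_measurable d T R).

Lemma norm_p_sqr q a : 2 <= q ->
  norm_p P (q / 2) (fun x => a x ^+ 2) = norm_p P q a ^+ 2.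
Proof.
move=> q2; rewrite unlock -(powR_mulrn 2 (powR_ge0 _ _)) -powRrM.
have -> : (q / 2)^-1 = q^-1 * 2%:R by rewrite invf_div mulrC.
have -> // : \int[P]_x (`|a x ^+ 2| `^ (q / 2)) = \int[P]_x (`|a x| `^ q).
by apply: eq_Rintegral => x _; rewrite ger0_norm ?sqr_ge0// powR_sqr.
Qed.

(** The hypothesis kills the cross term of [two_point]; the triangle inequality in L^(q/2) for a^2
    and (2 q + 1) b^2 does the rest. Squared norms therefore add up along a martingale, instead of
    norms. *)
Lemma norm_p_martingale q a b : 2 <= q -> bm a -> bm b ->
  \int[P]_x (a x * `|a x| `^ (q - 2) * b x) = 0 ->
  norm_p P q (fun x => a x + b x) ^+ 2 <=
  norm_p P q a ^+ 2 + (2 * q + 1) * norm_p P q b ^+ 2.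
Proof.
move=> q2 ba bb ab0; have q1 : 1 <= q / 2 by lra.
set D := 2 * q + 1; have D0 : 0 <= D by rewrite /D; lra.
have ba2 := bmX 2 ba; have bb2 := bmX 2 bb.
have bD : bm (fun x => D * b x ^+ 2) by exact: bmZ.
have bS : bm (fun x => a x ^+ 2 + D * b x ^+ 2) by exact: bmD.
have S0 x : 0 <= a x ^+ 2 + D * b x ^+ 2.
  by apply: addr_ge0; [|apply: mulr_ge0 => //]; exact: sqr_ge0.
set c := norm_p P q a ^+ 2 + D * norm_p P q b ^+ 2.
have c0 : 0 <= c.
  by apply: addr_ge0; [|apply: mulr_ge0 => //]; exact: sqr_ge0.
have bq : bm (fun x => a x * `|a x| `^ (q - 2) * b x).
  have q20 : 0 <= q - 2 by lra.
  exact: (bmM (bmM ba (bm_norm_powR q20 ba)) bb).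
suff : norm_p P q (fun x => a x + b x) <= c `^ 2^-1.
  move=> h; rewrite -[leRHS](powRr1 c0) (_ : 1 = 2^-1 * 2); last by field.
  rewrite powRrM (powR_mulrn 2) ?powR_ge0//.
  by rewrite ler_pXn2r ?nnegrE ?norm_p_ge0 ?powR_ge0.
apply: le_norm_p; [lra|exact: powR_ge0|].
rewrite -powRrM mulrC.
apply: (@le_trans _ _ (\int[P]_x ((a x ^+ 2 + D * b x ^+ 2) `^ (q / 2)))).
  rewrite -[leRHS]add0r -(mulr0 q) -ab0 -EbmZ// -EbmD; last 2 first.
  - exact: bmZ.
  - by apply: bm_powR => //; lra.
  apply: Ebm_le => [||x].
  - by apply: bm_norm_powR; [lra|exact: bmD].
  - by apply: bmD; [exact: bmZ|apply: bm_powR => //; lra].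
  by have := two_point (a x) (b x) q2; rewrite !mulrA.
have := norm_p_D P q1 ba2 bD.
rewrite norm_pZ//; last lra.
rewrite !norm_p_sqr// (ger0_norm D0) -/c => h.
have hq : 0 < q / 2 by lra.
have <- : norm_p P (q / 2) (fun x => a x ^+ 2 + D * b x ^+ 2) `^ (q / 2) =
   \int[P]_x ((a x ^+ 2 + D * b x ^+ 2) `^ (q / 2)).
  rewrite (norm_p_powR _ _ hq).
  by apply: eq_Rintegral => x _; rewrite (ger0_norm (S0 x)).
by rewrite ge0_ler_powR ?nnegrE ?norm_p_ge0//; lra.
Qed.

End martingale_step.

(** * Conditional expectation and resampling on the product space *)

Section merge.
Context {R : realType} {I : choiceType}.
Local Notation E := (product_space R I).
Local Notation bm := (@bounded_measurable _ E R).

Definition merge (F : pred I) (x y : E) : E := fun i => if F i then x i else y i.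

(** The two copies exchange their coordinates outside F, which preserves nu x nu. *)
Definition merge_swap (F : pred I) (z : E * E) : E * E :=
  (merge F z.1 z.2, merge F z.2 z.1).

Definition depends_on (F : pred I) (g : E -> R) : Prop :=
  forall x y, (forall i, F i -> x i = y i) -> g x = g y.

Lemma depends_on_merge F g x y : depends_on F g -> g (merge F x y) = g x.
Proof. by apply=> i Fi; rewrite /merge Fi. Qed.

Lemma depends_on_mergeC F g x y : depends_on (predC F) g -> g (merge F x y) = g y.
Proof. by apply=> i /negPf/= Fi; rewrite /merge Fi. Qed.

Lemma depends_onW (F F' : pred I) g :
  (forall i, F i -> F' i) -> depends_on F g -> depends_on F' g.
Proof. by move=> FF' dg x y h; apply: dg => i /FF'; exact: h. Qed.

Let side (F : pred I) (i : I) : (I + I)%type := if F i then inl i else inr i.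

Let side2 (F : pred I) (k : (I + I)%type) : (I + I)%type :=
  match k with
  | inl i => if F i then inl i else inr i
  | inr i => if F i then inr i else inl i
  end.

Let mergeE F (z : E * E) : merge F z.1 z.2 = reindex (side F) (join z).
Proof. by apply/funext => i; rewrite /merge /reindex /side; case: ifP. Qed.

Let merge_swapE F (z : E * E) :
  merge_swap F z = split_pair (reindex (side2 F) (join z)).
Proof.
congr pair; apply/funext => i; rewrite /merge /reindex /side2 /=;
  by case: ifP.
Qed.

Lemma measurable_merge F :
  measurable_fun [set: E * E] (fun z => merge F z.1 z.2).
Proof.
rewrite (_ : (fun z => _) = fun z => reindex (side F) (join z)).
  exact: (measurableT_comp (@measurable_reindex _ _ _ _) measurable_join).
by apply/funext => z; exact: mergeE.
Qed.

Lemma measurable_merge_swap F : measurable_fun [set: E * E] (merge_swap F).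
Proof.
rewrite (_ : merge_swap F = fun z => split_pair (reindex (side2 F) (join z))).
  apply: (measurableT_comp measurable_split).
  exact: (measurableT_comp (@measurable_reindex _ _ _ _) measurable_join).
by apply/funext => z; exact: merge_swapE.
Qed.

Variables (mu : set R -> \bar R) (nu : probability E R).
Hypothesis inu : iid_law mu nu.

Lemma merge_law F A : measurable A ->
  (nu \x nu)%E ((fun z => merge F z.1 z.2) @^-1` A) = nu A.
Proof.
move=> mA.
rewrite (_ : (fun z => _) = fun z => reindex (side F) (join z)); last first.
  by apply/funext => z; exact: mergeE.
apply: (join_preserve inu _ mA) => i j; rewrite /side.
by case: (F i); case: (F j) => // -[].
Qed.

Lemma merge_swap_law F A : measurable A ->
  (nu \x nu)%E (merge_swap F @^-1` A) = (nu \x nu)%E A.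
Proof.
move=> mA; rewrite -[RHS](@join_preserve2 _ _ _ _ inu (side2 F) _ _ mA).
  by congr (_ _); apply/seteqP; split=> z /=; rewrite merge_swapE.
move=> [i|i] [j|j] /=; case Fi: (F i); case Fj: (F j) => // -[ij];
  by [rewrite ij|rewrite ij Fj in Fi].
Qed.

Lemma bm_merge F (g : E -> R) : bm g ->
  bounded_measurable (fun z : E * E => g (merge F z.1 z.2)).
Proof. exact: (bm_comp (measurable_merge F)). Qed.

(* Integrating over x and y separately is the Fubini form of the independence
   of the coordinates in F and those outside F. *)
Lemma Ebm_merge F (g : E -> R) : bm g ->
  \int[nu]_x g x = \int[nu]_x (\int[nu]_y g (merge F x y)).
Proof.
move=> bg; rewrite (Ebm_fubini nu nu (bm_merge F bg)) /=.
apply/esym; apply: (@Ebm_pushforward _ _ _ _ _ (nu \x nu)%E) => //.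
  exact: measurable_merge.
by move=> A mA; exact: merge_law.
Qed.

Lemma Ebm_merge_swap F (g : E * E -> R) : bounded_measurable g ->
  \int[(nu \x nu)%E]_z g (merge_swap F z) = \int[(nu \x nu)%E]_z g z.
Proof.
move=> bg; apply: (@Ebm_pushforward _ _ _ _ _ (nu \x nu)%E (nu \x nu)%E) => //.
  exact: measurable_merge_swap.
by move=> A mA; exact: merge_swap_law.
Qed.

(* Under a product law this is a version of E[g | x_i, F i]. *)
Definition cexp (F : pred I) (g : E -> R) : E -> R :=
  fun x => \int[nu]_y g (merge F x y).

Lemma bm_cexp F g : bm g -> bm (cexp F g).
Proof. by move=> bg; exact: (bm_partial nu nu (bm_merge F bg)). Qed.

Lemma cexp_depends F g : depends_on F (cexp F g).
Proof.
move=> x y xy; apply: eq_Rintegral => z _; congr g.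
by apply/funext => i; rewrite /merge; case: ifP => // /xy.
Qed.

Lemma bm_merge_section F g x : bm g -> bm (fun y => g (merge F x y)).
Proof. by move=> bg; exact: (bm_section (bm_merge F bg) x). Qed.

(** The defining property of conditional expectation; it reduces to Fubini because h does not see
    the coordinates that are integrated out. *)
Lemma Ebm_mul_cexp F g h : bm g -> bm h -> depends_on F h ->
  \int[nu]_x (h x * g x) = \int[nu]_x (h x * cexp F g x).
Proof.
move=> bg bh dh; rewrite (Ebm_merge F (bmM bh bg)).
apply: eq_Rintegral => x _; rewrite -EbmZ; last exact: bm_merge_section.
by apply: eq_Rintegral => y _; rewrite (depends_on_merge _ _ dh).
Qed.

(** In X_i the argument u of f is the innovation at i - u, so replacing the innovation at the origin
    resamples coordinate i of f. The physical dependence coefficient at i is thus the norm of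
    [resample] at i. *)
Definition resample (g : E -> R) (v : I) (z : E * E) : R :=
  g z.1 - g (merge (predC1 v) z.1 z.2).

Definition delta (g : E -> R) (q : R) (v : I) : R :=
  norm_p (nu \x nu)%E q (resample g v).

Lemma bm_resample g v : bm g -> bounded_measurable (resample g v).
Proof.
move=> bg; apply: bmB; last exact: bm_merge.
exact: (bm_comp measurable_fst).
Qed.

(** The increment at x is the integral over y of a difference h (x, y) of two values of g whose
    arguments differ at v alone. Swapping the copies outside F and v turns h into [resample], and
    Jensen's inequality moves the power inside. *)
Lemma norm_cexp_increment F v g q : 1 <= q -> bm g -> ~~ F v ->
  norm_p nu q (fun x => cexp (predU1 v F) g x - cexp F g x) <= delta g q v.
Proof.
move=> q1 bg Fv; have q0 : 0 < q by lra.
have br := bm_resample v bg.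
pose h (z : E * E) := g (merge (predU1 v F) z.1 z.2) - g (merge F z.1 z.2).
have hE z : h z = resample g v (merge_swap (predU1 v F) z).
  rewrite /h /resample /=; congr (_ - g _); apply/funext => i.
  rewrite /merge /=; case: eqVneq => [->|] //=.
  by rewrite (negPf Fv).
have bh : bounded_measurable h by apply: bmB; exact: bm_merge.
apply: le_norm_p => //; first exact: norm_p_ge0.
rewrite /delta norm_p_powR//.
rewrite -(Ebm_merge_swap (predU1 v F) (bm_norm_powR (ltW q0) br)).
under [leRHS]eq_Rintegral do rewrite -hE.
rewrite -(Ebm_fubini nu nu (bm_norm_powR (ltW q0) bh)).
have bhx x : bm (fun y => h (x, y)) by exact: bm_section.
apply: Ebm_le => [||x].
- by apply: bm_norm_powR; [exact: ltW|apply: bmB; exact: bm_cexp].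
- exact: (bm_partial nu nu (bm_norm_powR (ltW q0) bh)).
rewrite /cexp -EbmB; [|exact: bm_merge_section..].
exact: (jensen_powR nu q1 (bhx x)).
Qed.

Lemma norm_cexp_increments F (s : seq I) g q : 2 <= q -> bm g -> uniq s ->
  {in s, forall v, ~~ F v} ->
  norm_p nu q (fun x => cexp (predU (mem s) F) g x - cexp F g x) ^+ 2 <=
  (2 * q + 1) * \sum_(v <- s) delta g q v ^+ 2.
Proof.
move=> q2 bg; elim: s => [_ _|v s IH /= /andP[vs us] sF].
  rewrite big_nil mulr0 (_ : (fun x => _) = fun=> 0 * 0).
    by rewrite norm_pZ ?normr0 ?mul0r ?expr0n//; [lra|exact: bm_cst].
  by apply/funext => x; rewrite mul0r subrr.
pose F' : pred I := predU (mem s) F.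
have EF : (predU (mem (v :: s)) F : pred I) = (predU1 v F' : pred I).
  by apply/funext => i; rewrite /F' /= inE orbA.
have F'v : ~~ F' v by rewrite /F' /= negb_or vs sF// mem_head.
pose a x := cexp F' g x - cexp F g x.
pose b x := cexp (predU1 v F') g x - cexp F' g x.
have ba : bm a by apply: bmB; exact: bm_cexp.
have bb : bm b by apply: bmB; exact: bm_cexp.
have da : depends_on F' a.
  move=> x y xy; rewrite /a (cexp_depends g xy); congr (_ - _).
  by apply: cexp_depends => i Fi; apply: xy; rewrite /F' /= Fi orbT.
have -> : (fun x => cexp (predU (mem (v :: s)) F) g x - cexp F g x) =
    fun x => a x + b x.
  by apply/funext => x; rewrite /a /b [RHS]addrC subrKA EF.
apply: le_trans (norm_p_martingale q2 ba bb _) _.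
  (* [k] depends on the sites already revealed, so it has the same integral against both conditional
     expectations, namely the one against g; hence the orthogonality of the increment. *)
  pose k x := a x * `|a x| `^ (q - 2).
  have bk : bm k by apply: bmM => //; apply: bm_norm_powR => //; lra.
  have dk : depends_on F' k by move=> x y xy; rewrite /k (da _ _ xy).
  have dk' : depends_on (predU1 v F') k.
    by apply: depends_onW dk => i Fi /=; rewrite Fi orbT.
  rewrite -/(k _); under eq_Rintegral do rewrite -/(k _) mulrBr.
  rewrite EbmB; [|by apply: bmM => //; exact: bm_cexp..].
  by rewrite -!Ebm_mul_cexp// subrr.
rewrite big_cons mulrDr addrC lerD//; last first.
  by apply: IH => // u us'; apply: sF; rewrite inE us' orbT.
rewrite ler_wpM2l//; first lra.
rewrite ler_pXn2r ?nnegrE ?norm_p_ge0//.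
by apply: norm_cexp_increment => //; lra.
Qed.

End merge.

(** * Rosenthal's inequality *)

Section rosenthal.
Context {R : realType} {I : choiceType}.
Local Notation E := (product_space R I).
Local Notation bm := (@bounded_measurable _ E R).

Lemma japanese_sub2 p (u : R) :
  japanese p u * (u / (1 + u ^+ 2)) = u * japanese (p - 2) u.
Proof.
have r0 : 0 < 1 + u ^+ 2 by have := sqr_ge0 u; lra.
have -> : japanese p u = japanese (p - 2) u * (1 + u ^+ 2).
  rewrite /japanese -{3}(powRr1 (ltW r0)) -powRD; last by rewrite (gt_eqF r0) implybT.
  by congr (_ `^ _); field.
by field; rewrite gt_eqF.
Qed.

Lemma bm_japanese d (T : measurableType d) p (g : T -> R) : 0 <= p ->
  bounded_measurable g -> bounded_measurable (fun x => japanese p (g x)).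
Proof.
move=> p0 bg; apply: bm_powR => [|x|]; first by lra.
  by have := sqr_ge0 (g x); lra.
by apply: bmD; [exact: bm_cst|exact: bmX].
Qed.

Lemma bm_weight d (T : measurableType d) p (g : T -> R) : 0 <= p ->
  bounded_measurable g -> bounded_measurable (fun x => rosenthal_weight p (g x)).
Proof.
move=> p0 bg; apply: bmD; apply: bmZ; first exact: bmX.
exact: bm_norm_powR.
Qed.

Lemma rosenthal_weight_ge0 p (x : R) : 0 <= rosenthal_weight p x.
Proof.
apply: addr_ge0; apply: mulr_ge0; rewrite ?powR_ge0 ?sqr_ge0//.
by apply: mulr_ge0 => //; exact: powR_ge0.
Qed.

Variables (mu : set R -> \bar R) (nu : probability E R).
Hypothesis inu : iid_law mu nu.

Lemma Ebm_prod (g h : E -> R) : bm g -> bm h ->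
  \int[(nu \x nu)%E]_z (g z.1 * h z.2) = \int[nu]_x g x * \int[nu]_y h y.
Proof.
move=> bg bh; have b : bounded_measurable (fun z : E * E => g z.1 * h z.2).
  by apply: bmM; [exact: (bm_comp measurable_fst)|exact: (bm_comp measurable_snd)].
rewrite -(Ebm_fubini nu nu b) mulrC -EbmZ//.
by apply: eq_Rintegral => x _; rewrite /= EbmZ// mulrC.
Qed.

(** Y and S read disjoint sets of sites, so merging along D replaces them by functions of two
    independent points. The linear term of [japanese_step] becomes Y times a function of S and
    vanishes since Y is centered. *)
Lemma rosenthal_step (D : pred I) p (Y S : E -> R) : 2 <= p -> bm Y -> bm S ->
  depends_on D Y -> depends_on (predC D) S -> \int[nu]_x Y x = 0 ->
  \int[nu]_x japanese p (Y x + S x) <=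
  (1 + \int[nu]_x rosenthal_weight p (Y x)) * \int[nu]_x japanese p (S x).
Proof.
move=> p2 bY bS dY dS Y0; have p0 : 0 <= p by lra.
have p20 : 0 <= p - 2 by lra.
have bYS := bmD bY bS.
have bJ := bm_japanese p0 bS; have bW := bm_weight p0 bY.
have bK : bm (fun x => p * (S x * japanese (p - 2) (S x))).
  by apply: bmZ; apply: bmM => //; exact: bm_japanese.
have m1 (g : E -> R) : bm g -> bounded_measurable (fun z : E * E => g z.1).
  exact: (bm_comp measurable_fst).
have m2 (g : E -> R) : bm g -> bounded_measurable (fun z : E * E => g z.2).
  exact: (bm_comp measurable_snd).
rewrite (Ebm_merge inu D (bm_japanese p0 bYS)).
have bZ : bounded_measurable (fun z : E * E => japanese p (Y z.1 + S z.2)).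
  by apply: bm_japanese => //; apply: bmD; [exact: m1|exact: m2].
have -> : \int[nu]_x (\int[nu]_y japanese p
      (Y (merge D x y) + S (merge D x y))) =
    \int[(nu \x nu)%E]_z japanese p (Y z.1 + S z.2).
  rewrite -(Ebm_fubini nu nu bZ).
  apply: eq_Rintegral => x _; apply: eq_Rintegral => y _.
  by rewrite (depends_on_merge _ _ dY) (depends_on_mergeC _ _ dS).
have b1 : bounded_measurable (fun z : E * E => 1 * japanese p (S z.2)).
  exact: (bmZ 1 (m2 _ bJ)).
have b2 : bounded_measurable
    (fun z : E * E => Y z.1 * (p * (S z.2 * japanese (p - 2) (S z.2)))).
  exact: (bmM (m1 _ bY) (m2 _ bK)).
have b3 : bounded_measurable
    (fun z : E * E => rosenthal_weight p (Y z.1) * japanese p (S z.2)).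
  exact: (bmM (m1 _ bW) (m2 _ bJ)).
apply: (@le_trans _ _ (\int[(nu \x nu)%E]_z (1 * japanese p (S z.2) +
    Y z.1 * (p * (S z.2 * japanese (p - 2) (S z.2))) +
    rosenthal_weight p (Y z.1) * japanese p (S z.2)))).
  apply: Ebm_le => // [|z]; first by apply: bmD => //; exact: bmD.
  rewrite addrC; apply: (le_trans (japanese_step _ _ p2)).
  by rewrite -japanese_sub2 le_eqVlt; apply/orP; left; apply/eqP; ring.
rewrite (@EbmD _ _ _ (nu \x nu)%E)//; last exact: bmD.
rewrite (@EbmD _ _ _ (nu \x nu)%E)//.
rewrite (Ebm_prod (@bm_cst _ _ _ 1) bJ) (Ebm_prod bY bK) (Ebm_prod bW bJ).
by rewrite Ebm_cst Y0 mul0r addr0 -mulrDl.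
Qed.

Lemma rosenthal_product (J : eqType) (s : seq J) (D : J -> pred I)
    (Y : J -> E -> R) p : 2 <= p -> uniq s ->
  (forall j, bm (Y j)) -> (forall j, depends_on (D j) (Y j)) ->
  (forall j, \int[nu]_x Y j x = 0) ->
  {in s &, forall j j', j != j' -> forall i, D j i -> ~~ D j' i} ->
  \int[nu]_x japanese p (\sum_(j <- s) Y j x) <=
  \prod_(j <- s) (1 + \int[nu]_x rosenthal_weight p (Y j x)).
Proof.
move=> p2 + bY dY Y0; elim: s => [_ _|j s IH /= /andP[js us] disj].
  rewrite big_nil; under eq_Rintegral do rewrite big_nil.
  by rewrite Ebm_cst /japanese expr0n addr0 powR1.
rewrite big_cons; under eq_Rintegral do rewrite big_cons.
have dS : depends_on (predC (D j)) (fun x => \sum_(k <- s) Y k x).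
  move=> x y xy; rewrite big_seq [RHS]big_seq; apply: eq_bigr => k ks.
  apply: dY => i Di; apply: xy => /=.
  apply: (disj k j) => //; rewrite ?mem_head ?inE ?ks ?orbT//.
  by apply: contraNneq js => <-.
apply: le_trans (rosenthal_step p2 (bY j) (bm_sum s bY) (dY j) dS (Y0 j)) _.
rewrite ler_wpM2l//.
  by rewrite addr_ge0//; apply: Ebm_ge0 => x; exact: rosenthal_weight_ge0.
by apply: IH => // k k' ks ks'; apply: disj; rewrite inE ?ks ?ks' orbT.
Qed.

(** The bound ln x <= x / 2 at x = p^(1/4). It is what keeps the quadratic part of the weight, of
    order p^(1/2) (ln p)^2, below a multiple of p. *)
Lemma ln_le_fourth_root (p : R) : 0 < p -> ln p ^+ 2 <= 4 * p `^ 2^-1 \/ ln p < 0.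
Proof.
move=> p0; have [L0|] := leP 0 (ln p); [left|by right].
have q0 : 0 < p `^ 4^-1 by rewrite powR_gt0.
have h : ln p = 4 * ln (p `^ 4^-1) by rewrite ln_powR mulrA divff ?mul1r.
have h1 : ln p <= 2 * p `^ 4^-1 by have := ln_le_half q0; lra.
have -> : p `^ 2^-1 = p `^ 4^-1 ^+ 2.
  by rewrite -(powR_mulrn 2 (ltW q0)) -powRrM; congr (_ `^ _); field.
have -> : 4 * p `^ 4^-1 ^+ 2 = (2 * p `^ 4^-1) ^+ 2 by ring.
by rewrite ler_pXn2r ?nnegrE//; lra.
Qed.

Lemma expR1_le3 : expR 1 <= 3 :> R.
Proof. by have := @expR_le_quad R 1; lra. Qed.

(* The normalisation of the summands by [t] is where the rate p / ln p arises:
   it makes both parts of the accumulated weight at most linear in p. *)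
Lemma rosenthal (J : eqType) (s : seq J) (D : J -> pred I)
    (Y : J -> E -> R) p : 2 <= p -> uniq s ->
  (forall j, bm (Y j)) -> (forall j, depends_on (D j) (Y j)) ->
  (forall j, \int[nu]_x Y j x = 0) ->
  {in s &, forall j j', j != j' -> forall i, D j i -> ~~ D j' i} ->
  norm_p nu p (fun x => \sum_(j <- s) Y j x) <=
  12 * (p / ln p) * ((\sum_(j <- s) norm_p nu 2 (Y j) ^+ 2) `^ 2^-1 +
    (\sum_(j <- s) norm_p nu p (Y j) `^ p) `^ p^-1).
Proof.
move=> p2 us bY dY Y0 disj.
have p0 : 0 < p by lra.
have L0 : 0 < ln p by rewrite ln_gt0//; lra.
have pL : 0 < p / ln p by rewrite divr_gt0.
set A := \sum_(j <- s) norm_p nu 2 (Y j) ^+ 2.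
set B := \sum_(j <- s) norm_p nu p (Y j) `^ p.
have A0 : 0 <= A by apply: sumr_ge0 => j _; exact: sqr_ge0.
have B0 : 0 <= B by apply: sumr_ge0 => j _; exact: powR_ge0.
set c := A `^ 2^-1 + B `^ p^-1.
have c0 : 0 <= c by rewrite addr_ge0 ?powR_ge0.
have bS := bm_sum s bY.
(* The scale t must be positive while c may vanish, so t is taken slightly above 4 (p / ln p) c. The
   final constant is 12 = 3 * 4. *)
suff H (t : R) : 0 < t -> 4 * (p / ln p) * c <= t ->
    norm_p nu p (fun x => \sum_(j <- s) Y j x) <= 3 * t.
  apply/ler_addgt0Pr => e e0.
  have t0 : 0 < 4 * (p / ln p) * c + e / 3.
    rewrite ltr_wpDl ?divr_gt0// mulr_ge0//; lra.
  apply: le_trans (H _ t0 _) _; first by rewrite lerDl divr_ge0//; lra.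
  by rewrite le_eqVlt; apply/orP; left; apply/eqP; field; lra.
move=> t0 ct.
have tN : t != 0 by rewrite gt_eqF.
pose Z j (x : E) := t^-1 * Y j x.
have bZ j : bm (Z j) by exact: bmZ.
have dZ j : depends_on (D j) (Z j) by move=> x y xy; rewrite /Z (dY j _ _ xy).
have Z0 j : \int[nu]_x Z j x = 0 by rewrite EbmZ// Y0 mulr0.
have SZ : (fun x => \sum_(j <- s) Y j x) = (fun x => t * \sum_(j <- s) Z j x).
  by apply/funext => x; rewrite -mulr_sumr mulrA divff// mul1r.
rewrite SZ norm_pZ//; last exact: bm_sum.
rewrite (gtr0_norm t0) mulrC ler_pM2r//.
(* It remains to bound the p-th moment by e^p, that is, the accumulated weight by p; the two parts
   give p/4 and 9/8, and p/4 + 9/8 <= p for p >= 2. *)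
apply: le_trans expR1_le3; apply: le_norm_p => //.
rewrite -expRM mul1r.
apply: (@le_trans _ _ (\int[nu]_x japanese p (\sum_(j <- s) Z j x))).
  apply: Ebm_le => [||x].
  - by apply: bm_norm_powR; [exact: ltW|exact: bm_sum].
  - by apply: bm_japanese; [exact: ltW|exact: bm_sum].
  by apply: le_japanese; exact: ltW.
apply: le_trans (rosenthal_product p2 us bZ dZ Z0 disj) _.
apply: (@le_trans _ _ (\prod_(j <- s)
    expR (\int[nu]_x rosenthal_weight p (Z j x)))).
  apply: ler_prod => j _; rewrite expR_ge1Dx andbT.
  by rewrite addr_ge0//; apply: Ebm_ge0 => x; exact: rosenthal_weight_ge0.
rewrite -expR_sum ler_expR.
have tVp : t^-1 `^ p = (t `^ p)^-1.
  by rewrite -(powR_inv1 (ltW t0)) -powRrM mulN1r powRN.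
have e2 j : \int[nu]_x (Z j x ^+ 2) = (t ^+ 2)^-1 * norm_p nu 2 (Y j) ^+ 2.
  rewrite -(powR_mulrn 2 (norm_p_ge0 _ _ _)) norm_p_powR// -EbmZ; last first.
    exact: bm_norm_powR.
  apply: eq_Rintegral => x _; rewrite /Z exprMn exprVn (powR_mulrn 2)//.
  by rewrite real_normK ?num_real.
have ep j : \int[nu]_x (`|Z j x| `^ p) = (t `^ p)^-1 * norm_p nu p (Y j) `^ p.
  rewrite (norm_p_powR _ _ p0) -EbmZ; last exact: (bm_norm_powR (ltW p0)).
  apply: eq_Rintegral => x _; rewrite /Z normrM powRM//.
  by rewrite normfV (gtr0_norm t0) tVp.
have wE j : \int[nu]_x rosenthal_weight p (Z j x) =
    p `^ (5 / 2) / t ^+ 2 * norm_p nu 2 (Y j) ^+ 2 +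
    2 * (3 * p / ln p) `^ p / t `^ p * norm_p nu p (Y j) `^ p.
  have b2 := bmX 2 (bZ j); have bp := bm_norm_powR (ltW p0) (bZ j).
  rewrite /rosenthal_weight (EbmD nu (bmZ _ b2) (bmZ _ bp)).
  by rewrite (EbmZ nu _ b2) (EbmZ nu _ bp) e2 ep !mulrA.
under eq_bigr do rewrite wE.
rewrite big_split/= -!mulr_sumr -/A -/B.
have At : A `^ 2^-1 <= ln p / (4 * p) * t.
  rewrite -(@ler_pM2l _ (4 * (p / ln p))); last by rewrite mulr_gt0.
  have -> : 4 * (p / ln p) * (ln p / (4 * p) * t) = t by field; lra.
  apply: le_trans ct; apply: ler_wpM2l; first by rewrite mulr_ge0// ltW.
  by rewrite /c lerDl powR_ge0.
have Bt : B `^ p^-1 <= ln p / (4 * p) * t.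
  rewrite -(@ler_pM2l _ (4 * (p / ln p))); last by rewrite mulr_gt0.
  have -> : 4 * (p / ln p) * (ln p / (4 * p) * t) = t by field; lra.
  apply: le_trans ct; apply: ler_wpM2l; first by rewrite mulr_ge0// ltW.
  by rewrite /c lerDr powR_ge0.
have l0 : 0 <= ln p / (4 * p) by apply: divr_ge0; lra.
have k0 : 0 <= ln p / (4 * p) * t by apply: mulr_ge0 => //; exact: ltW.
have A2 : A <= (ln p / (4 * p)) ^+ 2 * t ^+ 2.
  rewrite -exprMn [leLHS](_ : A = (A `^ 2^-1) ^+ 2).
    by apply: lerXn2r => //; rewrite nnegrE ?powR_ge0.
  by rewrite -(powR_mulrn 2 (powR_ge0 _ _)) -powRrM mulVf ?powRr1.
have B2 : B <= (ln p / (4 * p)) `^ p * t `^ p.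
  rewrite -(powRM _ l0 (ltW t0)).
  rewrite [leLHS](_ : B = (B `^ p^-1) `^ p).
    by apply: ge0_ler_powR; rewrite ?nnegrE ?powR_ge0// ltW.
  by rewrite -powRrM mulVf ?powRr1// gt_eqF.
(* After normalisation this part is p^(1/2) (ln p)^2 / 16, and (ln p)^2 <= 4 p^(1/2). *)
have h1 : p `^ (5 / 2) / t ^+ 2 * A <= p / 4.
  apply: (@le_trans _ _ (p `^ (5 / 2) / t ^+ 2 *
      ((ln p / (4 * p)) ^+ 2 * t ^+ 2))).
    by rewrite ler_wpM2l// divr_ge0 ?powR_ge0 ?sqr_ge0.
  have -> : p `^ (5 / 2) = p ^+ 2 * p `^ 2^-1.
    rewrite -powR_mulrn; last lra.
    rewrite -powRD; first by congr (_ `^ _); field.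
    by rewrite (gt_eqF p0) implybT.
  have -> : p ^+ 2 * p `^ 2^-1 / t ^+ 2 * ((ln p / (4 * p)) ^+ 2 * t ^+ 2) =
      p `^ 2^-1 * ln p ^+ 2 / 16 by field; rewrite tN gt_eqF.
  case: (ln_le_fourth_root p0) => [h|]; last by lra.
  have q0 : 0 <= p `^ 2^-1 by exact: powR_ge0.
  have := ler_wpM2l q0 h.
  have -> : p `^ 2^-1 * (4 * p `^ 2^-1) = 4 * p.
    rewrite mulrCA -powRD ?(gt_eqF p0) ?implybT//.
    by rewrite (_ : 2^-1 + 2^-1 = 1) ?powRr1//; [lra|field].
  lra.
(* The bases multiply to (3 p / ln p) (ln p / (4 p)) = 3/4, and 2 (3/4)^p <= 2 (3/4)^2 = 9/8; the
   factor 4 in the choice of t makes this base less than 1. *)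
have h2 : 2 * (3 * p / ln p) `^ p / t `^ p * B <= 9 / 8.
  have tp : 0 < t `^ p by exact: powR_gt0.
  apply: (@le_trans _ _ (2 * (3 * p / ln p) `^ p / t `^ p *
      ((ln p / (4 * p)) `^ p * t `^ p))).
    by rewrite ler_wpM2l// divr_ge0 ?powR_ge0// mulr_ge0 ?powR_ge0.
  have -> : 2 * (3 * p / ln p) `^ p / t `^ p *
      ((ln p / (4 * p)) `^ p * t `^ p) =
      2 * ((3 * p / ln p) `^ p * (ln p / (4 * p)) `^ p).
    by field; rewrite gt_eqF.
  rewrite -powRM; [|by rewrite divr_ge0//; lra..].
  have -> : 3 * p / ln p * (ln p / (4 * p)) = 3 / 4 by field; rewrite !gt_eqF.
  have : (3 / 4) `^ p <= (3 / 4) `^ 2 :> R.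
    by rewrite ger_powR//; apply/andP; split; lra.
  rewrite (powR_mulrn 2) ?divr_ge0//; lra.
lra.
Qed.

End rosenthal.

(** * Layers *)

(** Each s_c is minorised by the tangent of t^r at the mean of the roots s_c^(1/r), and the linear
    terms cancel in the sum. The exponent 1 - 1/r of the number of classes is the one carried by (4
    j + 4)^d in the theorem. *)
Lemma power_mean (R : realType) (C : finType) (s : C -> R) (r : R) :
  1 <= r -> (forall c, 0 <= s c) ->
  \sum_c s c `^ r^-1 <= #|C|%:R `^ (1 - 1 / r) * (\sum_c s c) `^ r^-1.
Proof.
move=> r1 s0; have r0 : 0 < r by lra.
have [C0|C0] := posnP #|C|.
  rewrite big_pred0; first by rewrite mulr_ge0 ?powR_ge0.
  by move=> c; have := fintype0 c C0.
set N : R := #|C|%:R; have N0 : 0 < N by rewrite ltr0n.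
set T := \sum_c _; have T0 : 0 <= T by apply: sumr_ge0 => c _; exact: powR_ge0.
have m0 : 0 <= T / N by rewrite divr_ge0// ltW.
have h : N * (T / N) `^ r <= \sum_c s c.
  have e c : (T / N) `^ r + r * (T / N) `^ (r - 1) * (s c `^ r^-1 - T / N) <= s c.
    have := powR_tangent r1 (powR_ge0 (s c) r^-1) m0.
    by rewrite -powRrM mulVf ?gt_eqF// powRr1.
  apply: le_trans (ler_sum _ (fun c _ => e c)).
  rewrite big_split/= -mulr_sumr sumrB !sumr_const -/T -[_ *+ #|C|]mulr_natl -/N.
  rewrite -[(T / N) *+ _]mulr_natl -/N mulrCA divff ?gt_eqF// mulr1 subrr mulr0 addr0.
  by [].
have S0 : 0 <= \sum_c s c by exact: sumr_ge0.
have h2 : T `^ r <= N `^ (r - 1) * \sum_c s c.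
  have -> : T = N * (T / N) by rewrite mulrCA divff ?mulr1// gt_eqF.
  rewrite (powRM _ (ltW N0) m0) -(mulr_powRB1 (ltW N0) r0).
  by rewrite -mulrA mulrCA ler_wpM2l ?powR_ge0.
have -> : N `^ (1 - 1 / r) * (\sum_c s c) `^ r^-1 =
    (N `^ (r - 1) * \sum_c s c) `^ r^-1.
  rewrite (powRM _ (powR_ge0 _ _) S0) -powRrM; congr (_ `^ _ * _).
  by field; rewrite gt_eqF.
rewrite -[leLHS](powRr1 T0) -[X in T `^ X](@mulfV _ r) ?gt_eqF// powRrM.
by apply: ge0_ler_powR; rewrite ?nnegrE ?invr_ge0 ?mulr_ge0 ?powR_ge0// ltW.
Qed.

Section lattice.
Context {d : nat}.
Implicit Types i k u : 'rV[int]_d.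

Lemma supnorm_ge i (q : 'I_d) : (absz (i ord0 q) <= supnorm i)%N.
Proof. exact: (leq_bigmax (F := fun q => absz (i ord0 q))). Qed.

(** The modulus is n.+1, so [residue (2 * j)] sorts points modulo 2 j + 1. *)
Definition residue (n : nat) i : {ffun 'I_d -> 'I_n.+1} :=
  [ffun q => inord (absz (modz (i ord0 q) n.+1))].

(** Two points within distance j of k differ by at most 2 j in each coordinate, less than the
    modulus 2 j + 1. *)
Lemma residue_disjoint j i i' k : residue (2 * j) i = residue (2 * j) i' ->
  (supnorm (i - k)%R < j.+1)%N -> (supnorm (i' - k)%R < j.+1)%N -> i = i'.
Proof.
move=> rr ik ik'; apply/rowP => q.
have := congr1 (fun g : {ffun _ -> _} => nat_of_ord (g q)) rr.
rewrite !ffunE.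
have h1 := leq_trans (supnorm_ge (i - k) q) ik.
have h2 := leq_trans (supnorm_ge (i' - k) q) ik'.
move: h1 h2; rewrite !mxE.
move: (i ord0 q) (i' ord0 q) (k ord0 q) => x x' y.
have m1 := @modz_ge0 x (2 * j).+1%:Z isT.
have m2 := @modz_ge0 x' (2 * j).+1%:Z isT.
have l1 := @ltz_pmod x (2 * j).+1%:Z isT.
have l2 := @ltz_pmod x' (2 * j).+1%:Z isT.
have d1 := divz_eq x (2 * j).+1%:Z.
have d2 := divz_eq x' (2 * j).+1%:Z.
move=> h1 h2.
rewrite !inordK; [|lia..].
move: (modz x _) (modz x' _) (divz x _) (divz x' _) d1 d2 m1 m2 l1 l2.
move=> r r' a b d1 d2 r0 r0' rn rn' rr'.
have {}rr' : r = r' by lia.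
subst r' x x'.
have [ab|ab|->//] := ltgtP a b.
  have : ((2 * j).+1%:Z <= (b - a) * (2 * j).+1%:Z)%R by nia.
  by move: h1 h2; rewrite mulrBl; move: (a * _) (b * _) => A B; lia.
have : ((2 * j).+1%:Z <= (a - b) * (2 * j).+1%:Z)%R by nia.
by move: h1 h2; rewrite mulrBl; move: (a * _) (b * _) => A B; lia.
Qed.

End lattice.

Section level.
Context {R : realType} {d : nat}.
Local Notation I := 'rV[int]_d.
Local Notation E := (product_space R I).
Local Notation bm := (@bounded_measurable _ E R).
Variables (mu : set R -> \bar R) (nu : probability E R).
Hypothesis inu : iid_law mu nu.

(** A translation composed with a reflection, since the argument u of f receives the innovation at i
    - u; X_i is f after this map. *)
Definition shift (i : I) : E -> E := reindex (fun u => i - u).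

Lemma measurable_shift i : measurable_fun [set: E] (shift i).
Proof. exact: measurable_reindex. Qed.

Lemma sub_inj (i : I) : injective (fun u => i - u).
Proof. by move=> u v /addrI /oppr_inj. Qed.

Lemma shift_law i A : measurable A -> nu (shift i @^-1` A) = nu A.
Proof. exact: (iid_reindex (@sub_inj i) inu inu). Qed.

Lemma norm_shift q i (g : E -> R) : 0 <= q -> bm g ->
  norm_p nu q (fun x => g (shift i x)) = norm_p nu q g.
Proof.
move=> q0 bg; apply: (norm_p_pushforward q0 (measurable_shift i)) => //.
exact: shift_law.
Qed.

Lemma Ebm_shift i (g : E -> R) : bm g ->
  \int[nu]_x g (shift i x) = \int[nu]_x g x.
Proof.
move=> bg; apply: (Ebm_pushforward (measurable_shift i)) => //.
exact: shift_law.
Qed.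

(** The inequality is strict: [ball_pred 0] is empty, so the telescoping of layers starts from the
    mean, and layer j reveals exactly the sphere of radius j. *)
Definition ball_pred (j : nat) : pred I := fun u => (supnorm u < j)%N.

Definition sphere_seq (j : nat) : seq I :=
  enum_fset (fset_set [set u : I | supnorm u = j]).

Lemma mem_sphere_seq j u : (u \in sphere_seq j) = (supnorm u == j).
Proof.
rewrite /sphere_seq in_fset_set; last exact: finite_sphere.
by apply/idP/eqP; rewrite inE.
Qed.

Variable f : E -> R.
Hypothesis bf : bm f.

Definition layer (j : nat) (x : E) : R :=
  cexp nu (ball_pred j.+1) f x - cexp nu (ball_pred j) f x.

Lemma bm_layer j : bm (layer j).
Proof. by apply: bmB; exact: bm_cexp. Qed.

Lemma layer_depends j : depends_on (ball_pred j.+1) (layer j).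
Proof.
move=> x y xy; rewrite /layer (cexp_depends nu f xy); congr (_ - _).
by apply: cexp_depends => u uj; apply: xy; exact: ltnW.
Qed.

Lemma Ebm_cexp F : \int[nu]_x cexp nu F f x = \int[nu]_x f x.
Proof. by rewrite -(Ebm_merge inu F bf). Qed.

Lemma Ebm_layer j : \int[nu]_x layer j x = 0.
Proof. by rewrite EbmB ?Ebm_cexp ?subrr//; exact: bm_cexp. Qed.

Definition sphere_delta (q : R) (j : nat) : R :=
  (\sum_(u <- sphere_seq j) delta nu f q u ^+ 2) `^ 2^-1.

Lemma norm_layer q j : 2 <= q ->
  norm_p nu q (layer j) <= Num.sqrt (2 * q + 1) * sphere_delta q j.
Proof.
move=> q2; have sE : (predU (mem (sphere_seq j)) (ball_pred j) : pred I) =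
    ball_pred j.+1.
  apply/funext => u /=; rewrite -[LHS]/((u \in sphere_seq j) || _).
  by rewrite mem_sphere_seq /ball_pred ltnS -leq_eqVlt.
have := norm_cexp_increments inu (F := ball_pred j) (s := sphere_seq j) q2 bf.
rewrite sE => h.
have {h} := h (fset_uniq _) _; set A := \sum_(_ <- _) _.
have A0 : 0 <= A by apply: sumr_ge0 => u _; exact: sqr_ge0.
move=> h; rewrite /sphere_delta -/A powR12_sqrt// -sqrtrM; last by lra.
rewrite -[leLHS]ger0_norm ?norm_p_ge0// -sqrtr_sqr ler_wsqrtr//.
by apply: h => u; rewrite mem_sphere_seq /ball_pred => /eqP ->; rewrite ltnn.
Qed.

(** Since 2 (2 j + 1) <= 4 j + 4, a factor 2^d is to spare; its power 1 - 1/r >= 1/2 is at least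
    sqrt 2 as d >= 1. *)
Lemma volume_bound (j : nat) (r : R) : (1 <= d)%N -> 2 <= r ->
  Num.sqrt 2 * #|{ffun 'I_d -> 'I_(2 * j).+1}|%:R `^ (1 - 1 / r) <=
  ((4 * j + 4)%N%:R : R) `^ (d%:R * (1 - 1 / r)).
Proof.
move=> d1 r2; set a := 1 - 1 / r.
have a2 : 2^-1 <= a.
  by rewrite /a lerBrDr -lerBrDl div1r (_ : 1 - 2^-1 = 2^-1) ?lef_pV2 ?posrE//; lra.
rewrite card_ffun !card_ord natrX powRrM -powR12_sqrt//.
rewrite (powR_mulrn d)//.
have h : (2 : R) `^ 2^-1 <= (2 ^+ d) `^ a.
  apply: (@le_trans _ _ (2 `^ a)); first by rewrite ler_powR//; lra.
  apply: ge0_ler_powR; rewrite ?nnegrE ?exprn_ge0//; first lra.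
  by rewrite -[leLHS]expr1 ler_weXn2l//; lra.
have n0 : 0 <= ((2 * j).+1%:R : R) ^+ d by rewrite exprn_ge0.
apply: (@le_trans _ _ ((2 ^+ d) `^ a * ((2 * j).+1%:R ^+ d) `^ a)).
  by rewrite ler_wpM2r// powR_ge0.
rewrite -powRM ?exprn_ge0// -exprMn; apply: ge0_ler_powR.
- lra.
- by rewrite nnegrE exprn_ge0// mulr_ge0.
- by rewrite nnegrE exprn_ge0.
apply: lerXn2r; rewrite ?nnegrE ?mulr_ge0//.
by rewrite -natrM ler_nat; lia.
Qed.

Lemma level_sum (s : seq I) (a : I -> R) p j : 2 <= p -> uniq s ->
  norm_p nu p (fun x => \sum_(i <- s) a i * layer j (shift i x)) <=
  12 * (p / ln p) * (
    #|{ffun 'I_d -> 'I_(2 * j).+1}|%:R `^ (1 - 1 / 2) *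
      (\sum_(i <- s) a i ^+ 2) `^ 2^-1 * norm_p nu 2 (layer j) +
    #|{ffun 'I_d -> 'I_(2 * j).+1}|%:R `^ (1 - 1 / p) *
      (\sum_(i <- s) `|a i| `^ p) `^ p^-1 * norm_p nu p (layer j)).
Proof.
move=> p2 us; have p0 : 0 < p by lra.
have L0 : 0 < ln p by rewrite ln_gt0//; lra.
pose C : finType := {ffun 'I_d -> 'I_(2 * j).+1}.
pose cls (c : C) := [seq i <- s | residue (2 * j) i == c].
pose Y i (x : E) := a i * layer j (shift i x).
have blay i : bm (fun x => layer j (shift i x)).
  exact: (bm_comp (measurable_shift i) (bm_layer j)).
have bY i : bm (Y i) by exact: bmZ.
(* The layer reads coordinate u of the shifted point, which is coordinate k = i - u of x; hence the
   ball around i. *)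
pose D i : pred I := fun k => ball_pred j.+1 (i - k).
have dY i : depends_on (D i) (Y i).
  move=> x y xy; rewrite /Y; congr (_ * _); apply: layer_depends => u uj.
  by apply: xy; rewrite /D subKr.
have Y0 i : \int[nu]_x Y i x = 0.
  by rewrite EbmZ// (Ebm_shift i (bm_layer j)) Ebm_layer mulr0.
have disj c : {in cls c &, forall i i', i != i' -> forall k, D i k -> ~~ D i' k}.
  move=> i i'; rewrite !mem_filter => /andP[/eqP ic _] /andP[/eqP i'c _].
  move=> ii' k ik; apply: contra ii' => i'k; apply/eqP.
  by apply: (@residue_disjoint _ j i i' k) => //; rewrite ic i'c.
have nY q i : 0 < q -> norm_p nu q (Y i) = `|a i| * norm_p nu q (layer j).
  by move=> q0; rewrite norm_pZ// norm_shift// ?ltW//; exact: bm_layer.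
have sumE (F : I -> R) : \sum_(i <- s) F i = \sum_c \sum_(i <- cls c) F i.
  rewrite (partition_big (residue (2 * j)) xpredT)//=.
  by apply: eq_bigr => c _; rewrite big_filter.
have SE : (fun x => \sum_(i <- s) a i * layer j (shift i x)) =
    (fun x => \sum_c \sum_(i <- cls c) Y i x).
  by apply/funext => x; rewrite -sumE.
rewrite SE.
apply: le_trans (norm_p_sum _ _ _ _) _; [lra|by move=> c; exact: bm_sum|].
have K0 : 0 <= 12 * (p / ln p) by rewrite mulr_ge0// divr_ge0// ltW.
apply: (@le_trans _ _ (\sum_(c : C) 12 * (p / ln p) *
   ((\sum_(i <- cls c) a i ^+ 2) `^ 2^-1 * norm_p nu 2 (layer j) +
    (\sum_(i <- cls c) `|a i| `^ p) `^ p^-1 * norm_p nu p (layer j)))).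
  apply: ler_sum => c _.
  apply: le_trans (rosenthal inu p2 (filter_uniq _ us) bY dY Y0 (disj c)) _.
  rewrite ler_wpM2l//.
  have n2 : 0 <= norm_p nu 2 (layer j) by exact: norm_p_ge0.
  have np : 0 <= norm_p nu p (layer j) by exact: norm_p_ge0.
  rewrite le_eqVlt; apply/orP; left; apply/eqP; congr (_ + _).
    under eq_bigr do rewrite nY// exprMn real_normK ?num_real//.
    rewrite -mulr_suml powRM ?sqr_ge0 ?sumr_ge0// => [|i _]; last exact: sqr_ge0.
    by rewrite -(powR_mulrn 2 n2) -powRrM mulfV// powRr1.
  under eq_bigr do rewrite nY// powRM//.
  have B0 : 0 <= \sum_(i <- cls c) `|a i| `^ p.
    by apply: sumr_ge0 => i _; exact: powR_ge0.
  rewrite -mulr_suml (powRM _ B0 (powR_ge0 _ _)).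
  by rewrite -powRrM mulfV ?gt_eqF// powRr1.
rewrite -mulr_sumr ler_wpM2l// big_split/= -!mulr_suml.
apply: lerD; apply: ler_wpM2r; rewrite ?norm_p_ge0// sumE.
  by apply: power_mean => [|c]; [lra|apply: sumr_ge0 => i _; exact: sqr_ge0].
by apply: power_mean => [|c]; [lra|apply: sumr_ge0 => i _; exact: powR_ge0].
Qed.

(** Here the constants are matched. The two factors sqrt 2, one explicit and one from
    [volume_bound], make 29 available against 12 sqrt (2 q + 1). The comparison [key] is used with q
    = 2, k = 1, where 144 * 5 <= 29^2, and with q = p, k = sqrt (p - 1), where 144 (2 p + 1) <= 29^2
    (p - 1). *)
Lemma level_bound (s : seq I) (a : I -> R) p j : (1 <= d)%N -> 2 <= p -> uniq s ->
  norm_p nu p (fun x => \sum_(i <- s) a i * layer j (shift i x)) <=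
  Num.sqrt 2 * (29 / 2 * p / ln p) * (\sum_(i <- s) a i ^+ 2) `^ 2^-1 *
    (((4 * j + 4)%N%:R : R) `^ (d%:R / 2) * sphere_delta 2 j) +
  Num.sqrt 2 * (29 / 2 * p / ln p) * Num.sqrt (p - 1) *
    (\sum_(i <- s) `|a i| `^ p) `^ p^-1 *
    (((4 * j + 4)%N%:R : R) `^ (d%:R * (1 - 1 / p)) * sphere_delta p j).
Proof.
move=> d1 p2 us; apply: le_trans (level_sum a j p2 us) _.
have L0 : 0 < ln p by rewrite ln_gt0//; lra.
have pL : 0 <= p / ln p by rewrite divr_ge0//; lra.
have r2 : 0 < Num.sqrt (2 : R) by rewrite sqrtr_gt0.
have r22 : Num.sqrt (2 : R) * Num.sqrt 2 = 2 by rewrite -expr2 sqr_sqrtr.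
have key (q k V W A n S : R) : 0 <= k -> 12 * Num.sqrt (2 * q + 1) <= 29 * k ->
    Num.sqrt 2 * V <= W -> 0 <= V -> 0 <= A -> 0 <= S ->
    n <= Num.sqrt (2 * q + 1) * S ->
    12 * (p / ln p) * (V * A * n) <=
    Num.sqrt 2 * (29 / 2 * p / ln p) * k * A * (W * S).
  move=> k0 hk hV V0 A0 S0 hn.
  apply: (@le_trans _ _ (p / ln p * (V * A) * (29 * k * S))).
    have -> : 12 * (p / ln p) * (V * A * n) = p / ln p * (V * A) * (12 * n) by ring.
    apply: ler_wpM2l; first by apply: mulr_ge0 => //; exact: mulr_ge0.
    apply: (@le_trans _ _ (12 * Num.sqrt (2 * q + 1) * S)).
      by rewrite -[leRHS]mulrA ler_wpM2l.
    by rewrite ler_wpM2r.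
  have -> : p / ln p * (V * A) * (29 * k * S) =
      Num.sqrt 2 * (29 / 2 * p / ln p) * k * A * ((Num.sqrt 2 * V) * S).
    transitivity ((Num.sqrt 2 * Num.sqrt 2) * (29 / 2 * p / ln p) * k * A * (V * S)).
      by rewrite r22; field; lra.
    by ring.
  rewrite ler_wpM2l//; last by rewrite ler_wpM2r.
  apply: mulr_ge0 => //; apply: mulr_ge0 => //; apply: mulr_ge0; first exact: ltW.
  by rewrite -mulrA mulr_ge0.
rewrite mulrDr; apply: lerD.
  have := key 2 1 (#|{ffun 'I_d -> 'I_(2 * j).+1}|%:R `^ (1 - 1 / 2))
    (((4 * j + 4)%N%:R : R) `^ (d%:R / 2)) ((\sum_(i <- s) a i ^+ 2) `^ 2^-1)
    (norm_p nu 2 (layer j)) (sphere_delta 2 j).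
  rewrite !mulr1; apply; rewrite ?powR_ge0//.
  - have -> : (2 * 2 + 1 : R) = 5 by ring.
    rewrite -(@ler_pXn2r _ 2) ?nnegrE ?mulr_ge0// exprMn sqr_sqrtr//; lra.
  - have := @volume_bound j 2 d1 (lexx _).
    by rewrite (_ : d%:R * (1 - 1 / 2) = d%:R / 2 :> R)//; field.
  - exact: norm_layer.
apply: key => //; rewrite ?powR_ge0//; last 2 first.
- exact: volume_bound.
- exact: norm_layer.
rewrite -(@ler_pXn2r _ 2) ?nnegrE ?mulr_ge0// !exprMn !sqr_sqrtr//; lra.
Qed.

Lemma cexp_telescope N x :
  \sum_(0 <= j < N) layer j x = cexp nu (ball_pred N) f x - \int[nu]_y f y.
Proof.
rewrite telescope_sumr//; congr (_ - _); exact: eq_Rintegral.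
Qed.

End level.

(** * Approximation by functions of finitely many sites *)

Section cylinder_approximation.
Context {R : realType} {d : nat}.
Local Notation I := 'rV[int]_d.
Local Notation E := (product_space R I).
Local Notation bm := (@bounded_measurable _ E R).
Variable nu : probability E R.

(** L^1 density of the functions of finitely many sites; through [cexp_approx] it plays the part of
    Lévy's upward theorem. *)
Definition approximable (h : E -> R) : Prop :=
  forall e, 0 < e -> exists N g, [/\ bm g, depends_on (ball_pred N) g &
    \int[nu]_x `|h x - g x| <= e].

Lemma bm_dist (g h : E -> R) : bm g -> bm h -> bm (fun x => `|g x - h x|).
Proof. by move=> bg bh; apply: bm_norm; exact: bmB. Qed.

Lemma Ebm_dist_triangle (h k g : E -> R) : bm h -> bm k -> bm g ->
  \int[nu]_x `|h x - g x| <= \int[nu]_x `|h x - k x| + \int[nu]_x `|k x - g x|.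
Proof.
move=> bh bk bg; rewrite -EbmD; [|exact: bm_dist..].
apply: Ebm_le => [||x]; first exact: bm_dist.
  by apply: bmD; exact: bm_dist.
by rewrite -[h x - g x](subrKA (k x)) ler_normD.
Qed.

Lemma ball_predW M N u : (M <= N)%N -> ball_pred (d := d) M u -> ball_pred N u.
Proof. by move=> MN /leq_trans; exact. Qed.

Lemma approximable_lim (h : E -> R) : bm h ->
  (forall e, 0 < e -> exists k, [/\ bm k, approximable k &
    \int[nu]_x `|h x - k x| <= e]) -> approximable h.
Proof.
move=> bh H e e0; have e2 : 0 < e / 2 by rewrite divr_gt0.
have [k [bk ak hk]] := H _ e2.
have [N [g [bg dg kg]]] := ak _ e2.
exists N, g; split=> //; apply: le_trans (Ebm_dist_triangle bh bk bg) _; lra.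
Qed.

Lemma approximableD (h k : E -> R) : bm h -> bm k -> approximable h ->
  approximable k -> approximable (fun x => h x + k x).
Proof.
move=> bh bk ah ak e e0; have e2 : 0 < e / 2 by rewrite divr_gt0.
have [N [g [bg dg hg]]] := ah _ e2; have [M [l [bl dl kl]]] := ak _ e2.
exists (maxn N M), (fun x => g x + l x); split.
- exact: bmD.
- move=> x y xy; congr (_ + _); [apply: dg|apply: dl] => u uN; apply: xy.
    by apply: ball_predW uN; exact: leq_maxl.
  by apply: ball_predW uN; exact: leq_maxr.
apply: (@le_trans _ _ (\int[nu]_x (`|h x - g x| + `|k x - l x|))).
  apply: Ebm_le => [||x].
  - by apply: bm_dist; exact: bmD.
  - by apply: bmD; exact: bm_dist.
  by rewrite opprD addrACA ler_normD.
rewrite EbmD; [|exact: bm_dist..]; lra.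
Qed.

Lemma approximableZ (c : R) (h : E -> R) : bm h -> approximable h ->
  approximable (fun x => c * h x).
Proof.
move=> bh ah e e0.
have c0 : 0 < `|c| + 1 by rewrite ltr_wpDl.
have [N [g [bg dg hg]]] := ah _ (divr_gt0 e0 c0).
exists N, (fun x => c * g x); split.
- exact: bmZ.
- by move=> x y xy; rewrite (dg _ _ xy).
under eq_Rintegral do rewrite -mulrBr normrM.
rewrite EbmZ; last exact: bm_dist.
rewrite ler_pdivlMr// in hg; apply: le_trans hg; rewrite mulrC ler_wpM2l//.
  exact: Ebm_ge0.
by rewrite lerDl.
Qed.

Lemma approximable_sum (J : Type) (s : seq J) (F : J -> E -> R) :
  (forall j, bm (F j)) -> (forall j, approximable (F j)) ->
  approximable (fun x => \sum_(j <- s) F j x).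
Proof.
move=> bF aF; elim: s => [|j s IH].
  under eq_fun do rewrite big_nil.
  move=> e e0; exists 0%N, (fun=> 0); split=> //; first exact: bm_cst.
  by under eq_Rintegral do rewrite subrr normr0; rewrite Ebm_cst ltW.
under eq_fun do rewrite big_cons.
by apply: approximableD => //; exact: bm_sum.
Qed.

Lemma bm_indic (A : set E) : measurable A -> bm (\1_A : E -> R).
Proof.
move=> mA; split; first exact: measurable_indic.
by exists 1 => x; rewrite indicE ger0_norm//; case: (_ \in _).
Qed.

Lemma Ebm_indic (A : set E) : measurable A ->
  \int[nu]_x (\1_A x) = fine (nu A).
Proof. by move=> mA; rewrite /Rintegral integral_indic// setIT. Qed.

(** Dynkin's lemma: sets with approximable indicator form a lambda-system, closed under increasing
    unions by continuity of nu, and cylinders belong to it. *)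
Lemma approximable_indic (A : set E) : measurable A ->
  approximable (\1_A : E -> R).
Proof.
pose H := [set A : set E | measurable A /\ approximable (\1_A : E -> R)].
suff : @measurable _ E `<=` H by move=> h mA; have [] := h _ mA.
rewrite measurable_product_cylinders.
apply: lambda_system_subset => //; first exact: cylinders_setI.
- split=> //.
  + split; first exact: measurableT.
    rewrite indicT => e e0; exists 0%N, (fun=> 1); split=> //.
      exact: bm_cst.
    under eq_Rintegral do rewrite subrr normr0.
    by rewrite Ebm_cst ltW.
  + move=> B C CB [mB aB] [mC aC]; split; first exact: measurableD.
    rewrite (_ : \1_(B `\` C) = fun x => \1_B x + -1 * \1_C x).
      apply: approximableD => //; [exact: bm_indic|apply: bmZ; exact: bm_indic|].
      by apply: approximableZ => //; exact: bm_indic.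
    apply/funext => x; rewrite !indicE in_setD.
    have [xC|xC] := boolP (x \in C); last by rewrite andbT mulr0 addr0.
    rewrite andbF (_ : x \in B) ?mulr1 ?subrr//.
    by rewrite inE; apply: CB; rewrite inE in xC.
  + move=> F ndF HF; have mF i := (HF i).1.
    have mU : measurable (\bigcup_i F i) by exact: bigcup_measurable.
    split=> //; apply: approximable_lim; first exact: bm_indic.
    move=> e e0.
    have := nondecreasing_cvg_mu (mu := nu) mF mU ndF.
    rewrite -[X in _ --> X]fineK ?fin_num_measure//.
    move=> /fine_cvgP[_ /cvgrPdist_le/(_ _ e0)[n _ /(_ _ (leqnn n))]] h.
    exists (\1_(F n)); split; [exact: bm_indic|exact: (HF n).2|].
    have Fn : F n `<=` \bigcup_i F i by move=> x Fx; exists n.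
    rewrite (_ : \int[nu]_x _ = \int[nu]_x (\1_(\bigcup_i F i) x - \1_(F n) x)).
      rewrite EbmB; [|exact: bm_indic..].
      by rewrite !Ebm_indic//; apply: le_trans h; exact: ler_norm.
    apply: eq_Rintegral => x _; rewrite ger0_norm// !indicE subr_ge0.
    have [xF|xF] := boolP (x \in F n); last by rewrite ler0n.
    by rewrite (_ : x \in \bigcup_i F i)// inE; apply: Fn; rewrite inE in xF.
move=> _ [J [B [mB ->]]]; split; first exact: measurable_cylinder.
(* The successor is needed because [ball_pred] is strict; a cylinder is then its own
   approximation. *)
pose N := (\max_(k <- J) supnorm k).+1.
move=> e e0; exists N, (\1_(cylinder J B)); split.
- by apply: bm_indic; exact: measurable_cylinder.
- move=> x y xy; rewrite !indicE; congr (_%:R); congr nat_of_bool.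
  have kN k : k \in J -> x k = y k.
    move=> kJ; apply: xy; rewrite /ball_pred /N ltnS.
    exact: (leq_bigmax_seq (F := @supnorm d) k).
  by apply/idP/idP; rewrite !inE => h k kJ; have := h k kJ; rewrite kN.
under eq_Rintegral do rewrite subrr normr0.
by rewrite Ebm_cst ltW.
Qed.

Import HBSimple.

Lemma approximable_sfun (h : {sfun E >-> R}) : bm h /\ approximable h.
Proof.
have hE : (h : E -> R) = fun x => \sum_(y <- fset_set (range h))
    (y * \1_(h @^-1` [set y]) x).
  apply/funext => x; rewrite fimfunE fsbig_finite//; exact: fimfunP.
have mh y : measurable (h @^-1` [set y]) by exact: measurable_sfunP.
rewrite hE; split.
  by apply: bm_sum => y; apply: bmZ; exact: bm_indic.
apply: approximable_sum => y; first by apply: bmZ; exact: bm_indic.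
by apply: approximableZ; [exact: bm_indic|exact: approximable_indic].
Qed.

Lemma bm_approximable (h : E -> R) : bm h -> approximable h.
Proof.
move=> bh; apply: approximable_lim => // e e0.
have [g [ig _ gh]] := approximation_sfun_integrable measurableT (bm_integrable nu bh).
move/fine_cvgP: gh => [_ /cvgrPdist_le/(_ _ e0)[n _ /(_ _ (leqnn n))]] /= hn.
have [bg ag] := approximable_sfun (g n).
exists (g n); split=> //; move: hn.
rewrite sub0r normrN; apply: le_trans; apply: le_trans (ler_norm _).
exact: lexx.
Qed.

Variable mu : set R -> \bar R.
Hypothesis inu : iid_law mu nu.

(** Conditioning on a ball fixes a function g of that ball and contracts L^1, so the error is at
    most twice the distance from h to g. *)
Lemma cexp_approx (h : E -> R) : bm h -> forall e, 0 < e ->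
  exists N, \int[nu]_x `|h x - cexp nu (ball_pred N) h x| <= e.
Proof.
move=> bh e e0; have e2 : 0 < e / 2 by rewrite divr_gt0.
have [N [g [bg dg hg]]] := bm_approximable bh e2.
exists N; set F := ball_pred N.
have bc := bm_cexp nu F bh.
have gE : cexp nu F g = g.
  apply/funext => x; rewrite /cexp.
  under eq_Rintegral do rewrite (depends_on_merge _ _ dg).
  exact: Ebm_cst.
apply: le_trans (Ebm_dist_triangle bh bg bc) _.
suff : \int[nu]_x `|g x - cexp nu F h x| <= \int[nu]_x `|h x - g x| by lra.
rewrite [leRHS](Ebm_merge inu F (bm_dist bh bg)).
apply: Ebm_le => [||x]; first exact: bm_dist.
  exact: (bm_cexp nu F (bm_dist bh bg)).
rewrite -{1}gE /cexp -EbmB; [|exact: bm_merge_section..].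
apply: le_trans (le_normr_Rintegral _ _) _ => //.
  by apply: bm_integrable; apply: bmB; exact: bm_merge_section.
by under eq_Rintegral do rewrite distrC.
Qed.

End cylinder_approximation.

(** * Unbounded functions and infinite sums *)

Local Open Scope ereal_scope.

Lemma ereal_cvg0P (R : realType) (b : nat -> \bar R) : (forall n, 0 <= b n) ->
  (b @ \oo --> 0) <->
  (forall e, (0 < e)%R -> exists N, forall n, (N <= n)%N -> b n <= e%:E).
Proof.
move=> b0; split=> [/fine_cvgP[[N1 _ H1] /cvgrPdist_le H2] e e0|H].
  have [N2 _ H3] := H2 _ e0; exists (maxn N1 N2) => n.
  rewrite geq_max => /andP[n1 n2]; have := H3 n n2.
  rewrite /= sub0r normrN ger0_norm ?fine_ge0// => h.
  by rewrite -(fineK (H1 n n1)) lee_fin.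
have fb n e : b n <= e%:E -> b n \is a fin_num.
  by move=> h; rewrite ge0_fin_numE// (le_lt_trans h)// ltry.
apply/fine_cvgP; split.
  by have [N HN] := H 1%R ltr01; exists N => // n /= /HN; exact: fb.
apply/cvgrPdist_le => e e0; have [N HN] := H e e0; exists N => // n /= /HN h.
rewrite sub0r normrN ger0_norm ?fine_ge0//.
by rewrite -lee_fin fineK//; exact: fb h.
Qed.

(** * Completeness of L^1 *)

Section L1_completeness.
Context d (T : measurableType d) (R : realType) (P : probability T R).

(** The Riesz-Fischer argument: the series G of absolute increments is integrable, hence finite
    almost everywhere, and |V 0| + G dominates the whole sequence. *)
Lemma L1_fast_cvg (V : nat -> T -> R) :
  (forall n, P.-integrable setT (EFin \o V n)) ->
  (forall n, \int[P]_x `|V n.+1 x - V n x|%:E <= (1 / 2 ^+ n.+1)%:E) ->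
  exists S : T -> R, P.-integrable setT (EFin \o S) /\
    (fun n => \int[P]_x `|V n x - S x|%:E) @ \oo --> 0.
Proof.
move=> iV VV.
have mV n : measurable_fun setT (V n).
  by apply/measurable_EFinP; exact: measurable_int (iV n).
pose W n x := (`|V n.+1 x - V n x|%R)%:E.
have W0 n x : 0 <= W n x by rewrite lee_fin.
have mW n : measurable_fun setT (W n).
  by apply/measurable_EFinP; apply: measurableT_comp => //; exact: measurable_funB.
pose G x := \sum_(0 <= n <oo) W n x.
have G0 x : 0 <= G x by apply: nneseries_ge0 => n _ _.
have mG : measurable_fun setT G.
  by apply: ge0_emeasurable_sum => // k x _ _; exact: W0.
have iG : P.-integrable setT G.
  apply/integrableP; split=> //.
  under eq_integral do rewrite gee0_abs//.
  rewrite /G integral_nneseries//.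
  apply: le_lt_trans (ltry 1); apply: le_trans (epsilon_trick0 xpredT ler01).
  apply: lee_nneseries => [n _ _|n _]; first exact: integral_ge0.
  by apply: le_trans (VV n) _; rewrite lee_fin natrX.
have WV n x : (`|V n x| <= `|V 0%N x| + \sum_(0 <= k < n) `|V k.+1 x - V k x|)%R.
  elim: n => [|n IH]; first by rewrite big_nil addr0.
  rewrite big_nat_recr//= addrA.
  have -> : V n.+1 x = (V n x + (V n.+1 x - V n x))%R by rewrite addrCA subrr addr0.
  apply: le_trans (ler_normD _ _) _; rewrite lerD//.
  by rewrite addrCA subrr addr0.
have partial n x : (\sum_(0 <= k < n) `|V k.+1 x - V k x|)%:E <= G x.
  rewrite -sumEFin; apply: (@nneseries_lim_ge R (W ^~ x) xpredT 0 n) => k _ _.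
  exact: W0.
(* The upper limit is measurable on the whole space, including the points where the sequence
   diverges. *)
pose S x := fine (limn_esup (fun n => (V n x)%:E)).
have mS : measurable_fun setT S.
  apply: (measurableT_comp (@fine_measurable R _ measurableT)).
  by apply: measurable_fun_limn_esup => n; exact/measurable_EFinP.
have cS x : G x \is a fin_num -> (V n x)%:E @[n --> \oo] --> (S x)%:E.
  move=> Gx.
  have cV : cvgn (fun n => V n x).
    have -> : (fun n => V n x) =
        (fun n => V 0%N x + series (fun k => V k.+1 x - V k x)%R n)%R.
      apply/funext => n; rewrite /series/= telescope_sumr//.
      by rewrite addrCA subrr addr0.
    apply: is_cvgD; first exact: is_cvg_cst.
    apply: normed_cvg; apply: nondecreasing_is_cvgn.
      by apply: nondecreasing_series => k _ _ /=.
    exists (fine (G x)) => _ [n _ <-].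
    by rewrite -lee_fin fineK//; exact: partial.
  have cE : (V n x)%:E @[n --> \oo] --> (limn (fun n => V n x))%:E.
    by apply/fine_cvgP; split=> //; exact: nearW.
  rewrite /S is_cvg_limn_esupE; last by apply/cvg_ex; exists (limn (fun n => V n x))%:E.
  by rewrite (cvg_lim _ cE).
have dom n x : `|(V n x)%:E| <= `|(V 0%N x)%:E| + G x.
  apply: le_trans (leeD2l _ (partial n x)).
  by rewrite /= -EFinD lee_fin.
have ig : P.-integrable setT (fun x => `|(V 0%N x)%:E| + G x).
  apply: integrableD => //; exact: (integrable_norm (iV 0%N)).
have := @dominated_convergence _ _ R P setT measurableT
  (fun n => EFin \o V n) (EFin \o S) (fun x => `|(V 0%N x)%:E| + G x).
case.
- by move=> n; exact/measurable_EFinP.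
- exact/measurable_EFinP.
- have := integrable_ae measurableT iG; apply: filterS => x Gx _ /=.
  by apply: cS; exact: Gx.
- exact: ig.
- by apply: aeW => x n _; exact: dom.
by move=> iS cvg0 _; exists S; split.
Qed.

Lemma L1_complete (U : nat -> T -> R) :
  (forall n, P.-integrable setT (EFin \o U n)) ->
  (forall e, (0 < e)%R -> exists N, forall n m, (N <= n)%N -> (N <= m)%N ->
     \int[P]_x `|U n x - U m x|%:E <= e%:E) ->
  exists S : T -> R, P.-integrable setT (EFin \o S) /\
    (fun n => \int[P]_x `|U n x - S x|%:E) @ \oo --> 0.
Proof.
move=> iU cU.
have mU n : measurable_fun setT (U n).
  by apply/measurable_EFinP; exact: measurable_int (iU n).
have e2 k : (0 < 1 / 2 ^+ k.+1 :> R)%R by rewrite divr_gt0// exprn_gt0.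
have [N HN] := choice (fun k => cU _ (e2 k)).
(* The maximum puts [nk k] and [nk k.+1] beyond [N k], which makes the increments summable; the
   added k makes the indices tend to infinity. *)
pose nk k := ((\max_(j < k.+1) N j) + k)%N.
have nkN j k : (j <= k)%N -> (N j <= nk k)%N.
  move=> jk; apply: leq_trans (leq_addr _ _).
  exact: (leq_bigmax (F := fun j : 'I_k.+1 => N j) (Ordinal (jk : j < k.+1)%N)).
have [S [iS VS]] := @L1_fast_cvg (fun k => U (nk k)) (fun k => iU (nk k))
  (fun k => HN k _ _ (nkN _ _ (leqnSn k)) (nkN _ _ (leqnn k))).
have mS : measurable_fun setT S by apply/measurable_EFinP; exact: measurable_int iS.
exists S; split=> //.
have mD (f g : T -> R) : measurable_fun setT f -> measurable_fun setT g ->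
    measurable_fun setT (fun x => (`|f x - g x|%R)%:E).
  by move=> mf mg; apply/measurable_EFinP; apply: measurableT_comp => //;
    exact: measurable_funB.
apply/ereal_cvg0P => [n|e e0]; first exact: integral_ge0.
have eh : (0 < e / 2)%R by rewrite divr_gt0.
have [N1 H1] := cU _ eh.
have [|K HK] := (ereal_cvg0P _).1 VS _ eh; first by move=> n; exact: integral_ge0.
pose k := maxn K N1.
exists N1 => n N1n.
apply: (@le_trans _ _ (\int[P]_x (`|U n x - U (nk k) x|%:E + `|U (nk k) x - S x|%:E))).
  apply: ge0_le_integral => //; [exact: mD|by apply: emeasurable_funD; exact: mD|].
  move=> x _; rewrite -EFinD lee_fin -[(U n x - S x)%R](subrKA (U (nk k) x)).
  exact: ler_normD.
rewrite ge0_integralD//; [|exact: mD..].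
rewrite [e in e%:E](_ : e = e / 2 + e / 2)%R; last by field.
rewrite EFinD; apply: leeD.
  by apply: H1 => //; rewrite /nk (leq_trans (leq_maxr K N1))// leq_addl.
by apply: HK; exact: leq_maxl.
Qed.

End L1_completeness.

(** * Lower semicontinuity of the L^p norm under L^1 convergence *)

Section lower_semicontinuity.
Context d (T : measurableType d) (R : realType) (P : probability T R).

(** The truncated power is Lipschitz with constant p M^(p - 1), so an L^1 error suffices to compare
    p-th moments; this is the tangent inequality at the truncated value. *)
Lemma truncated_powR_le (p M x y : R) : (1 <= p)%R -> (0 <= M)%R ->
  (Num.min `|x| M `^ p <= `|y| `^ p + p * M `^ (p - 1) * `|y - x|)%R.
Proof.
move=> p1 M0; set m := Num.min _ _.
have m0 : (0 <= m)%R by rewrite /m le_min normr_ge0.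
have mM : (m <= M)%R by rewrite /m ge_min lexx orbT.
have mx : (m <= `|x|)%R by rewrite /m ge_min lexx.
have p0 : (0 <= p)%R by lra.
have p10 : (0 <= p - 1)%R by lra.
have h := powR_tangent p1 (normr_ge0 y) m0.
suff : (p * m `^ (p - 1) * (m - `|y|) <= p * M `^ (p - 1) * `|y - x|)%R by lra.
have k : (p * m `^ (p - 1) <= p * M `^ (p - 1))%R.
  by rewrite ler_wpM2l// ge0_ler_powR.
have [ym|ym] := leP m `|y|%R.
  apply: (@le_trans _ _ 0%R).
    by rewrite mulr_ge0_le0 ?subr_le0// mulr_ge0 ?powR_ge0.
  by rewrite mulr_ge0// mulr_ge0 ?powR_ge0.
apply: ler_pM => //.
- by rewrite mulr_ge0 ?powR_ge0.
- by rewrite subr_ge0 ltW.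
apply: (@le_trans _ _ (`|x| - `|y|)%R); first by rewrite lerD2r.
by rewrite distrC; exact: lerB_dist.
Qed.

(** The moment of |S| truncated at n is bounded by letting the L^1 error tend to 0 with n fixed;
    monotone convergence then removes the truncation. *)
Lemma Lnorm_lower_semicontinuous (p : R) (S : T -> R) (b : \bar R) :
  (1 <= p)%R -> measurable_fun setT S ->
  (forall e, (0 < e)%R -> exists g : T -> R, [/\ measurable_fun setT g,
     'N[P]_(p%:E)[EFin \o g] <= b &
     \int[P]_x `|g x - S x|%:E <= e%:E]) ->
  'N[P]_(p%:E)[EFin \o S] <= b.
Proof.
move=> p1 mS H; have p0 : (0 < p)%R by lra.
case: b H => [r|_|H]; [|by rewrite leey|]; last first.
  have [g [_ + _]] := H 1%R ltr01.
  by rewrite leeNy_eq => /eqP h; have := Lnorm_ge0 P p%:E (EFin \o g); rewrite h.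
move=> H.
have r0 : (0 <= r)%R.
  have [g [_ h _]] := H 1%R ltr01.
  by rewrite -lee_fin (le_trans _ h)// Lnorm_ge0.
pose c n x := (Num.min `|S x| n%:R `^ p)%R.
have mpow (g : T -> R) : measurable_fun setT g ->
    measurable_fun setT (fun x => (`|g x| `^ p)%R).
  move=> mg; apply: (measurableT_comp (measurable_powR _)).
  exact: measurableT_comp.
have mc n : measurable_fun setT (c n).
  apply: (measurableT_comp (measurable_powR _)).
  by apply: measurable_minr => //; exact: measurableT_comp.
have A n : \int[P]_x (c n x)%:E <= (r `^ p)%:E.
  (* K is the Lipschitz constant at truncation level n; the divisor K + 1 is positive even if K =
     0. *)
  apply/lee_addgt0Pr => e e0; set K := (p * n%:R `^ (p - 1))%R.
  have K0 : (0 <= K)%R by rewrite mulr_ge0 ?powR_ge0// ltW.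
  have K1 : (0 < K + 1)%R by lra.
  have [g [mg gr gS]] := H _ (divr_gt0 e0 K1).
  have mgS : measurable_fun setT (fun x => (`|g x - S x|)%R).
    by apply: measurableT_comp => //; exact: measurable_funB.
  pose f1 x := ((`|g x| `^ p)%R)%:E; pose f2 x := K%:E * (`|g x - S x|%R)%:E.
  have f10 x : setT x -> 0 <= f1 x by move=> _; rewrite lee_fin powR_ge0.
  have f20 x : setT x -> 0 <= f2 x by move=> _; rewrite mule_ge0.
  have m1 : measurable_fun setT f1 by exact/measurable_EFinP/mpow.
  have m2 : measurable_fun setT f2.
    by apply: measurable_funeM; exact/measurable_EFinP.
  apply: (@le_trans _ _ (\int[P]_x (f1 x + f2 x))).
    apply: ge0_le_integral => //.
    - by move=> x _; rewrite lee_fin powR_ge0.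
    - exact/measurable_EFinP.
    - exact: emeasurable_funD.
    - by move=> x _; rewrite /f2 -EFinM -EFinD lee_fin; exact: truncated_powR_le.
  rewrite (ge0_integralD P measurableT f10 m1 f20 m2) /f1 /f2.
  rewrite ge0_integralZl_EFin//; last exact/measurable_EFinP.
  apply: leeD.
    have : 'N[P]_p%:E[EFin \o g] `^ p <= r%:E `^ p.
      by rewrite gt0_ler_poweR// ?in_itv/= ?Lnorm_ge0 ?leey ?lee_fin ?r0// ltW.
    rewrite poweR_Lnorm ?gt_eqF// poweR_EFin.
  apply: (@le_trans _ _ (K%:E * (e / (K + 1))%:E)).
    by rewrite lee_wpmul2l.
  rewrite -EFinM lee_fin mulrCA ler_piMr ?ltW//.
  by rewrite ltr_pdivrMr//; lra.
have B : \int[P]_x (`|S x| `^ p)%:E <= (r `^ p)%:E.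
  have cS : \int[P]_x (c n x)%:E @[n --> \oo] --> \int[P]_x (`|S x| `^ p)%:E.
    have -> : \int[P]_x (`|S x| `^ p)%:E =
        \int[P]_x (limn (fun n => (c n x)%:E)).
      apply: eq_integral => x _; apply/esym/cvg_lim => //.
      apply: cvg_near_cst; exists (Num.bound `|S x|%R) => // n /= xn.
      rewrite /c min_l//.
      apply: le_trans (ltW (archi_boundP (normr_ge0 _))) _.
      by rewrite ler_nat.
    apply: cvg_monotone_convergence => //.
    - by move=> n; exact/measurable_EFinP.
    - by move=> n x _; rewrite lee_fin powR_ge0.
    - move=> x _ m n mn; rewrite lee_fin /c ge0_ler_powR ?nnegrE ?le_min//.
      + exact: ltW.
      + by rewrite normr_ge0 ler0n.
      + by rewrite normr_ge0 ler0n.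
      + by rewrite !ge_min lexx ler_nat mn !orbT.
  apply: (@cvge_le _ _ _ _ _ _ _ _ cS); exact: nearW.
rewrite unlock -[leRHS](poweRe1 (_ : 0 <= r%:E))//.
rewrite -(@mulfV _ p) ?gt_eqF// poweRrM gt0_ler_poweR ?invr_ge0 ?(ltW p0)//.
- by rewrite in_itv/= leey integral_ge0// => x _; rewrite poweR_ge0.
- by rewrite in_itv/= leey lee_fin powR_ge0.
Qed.

End lower_semicontinuity.

Lemma ge0_integral_transfer d d' (T : measurableType d) (T' : measurableType d')
    (R : realType) (P : {measure set T -> \bar R})
    (Q : {measure set T' -> \bar R}) (phi : T -> T') (h : T' -> \bar R) :
  measurable_fun [set: T] phi ->
  (forall A, measurable A -> P (phi @^-1` A) = Q A) ->
  measurable_fun [set: T'] h -> (forall y, 0 <= h y) ->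
  \int[P]_x h (phi x) = \int[Q]_y h y.
Proof.
move=> mphi PQ mh h0.
have QP A : measurable A -> A `<=` [set: T'] -> Q A = pushforward P phi A.
  by move=> mA _; rewrite /pushforward PQ.
rewrite (eq_measure_integral (pushforward P phi) QP).
by rewrite [RHS]ge0_integral_pushforward ?preimage_setT//.
Qed.

Lemma measurable_norm_poweR d (T : measurableType d) (R : realType)
    (g : T -> R) (q : R) :
  measurable_fun [set: T] g ->
  measurable_fun [set: T] (fun x => `|(EFin \o g) x| `^ q).
Proof.
move=> mg.
apply/measurable_EFinP; apply: (measurableT_comp (measurable_powR _)).
exact: measurableT_comp.
Qed.

Lemma Lnorm_transfer d d' (T : measurableType d) (T' : measurableType d')
    (R : realType) (P : {measure set T -> \bar R})
    (Q : {measure set T' -> \bar R}) (phi : T -> T') (g : T' -> R) (q : R) :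
  measurable_fun [set: T] phi ->
  (forall A, measurable A -> P (phi @^-1` A) = Q A) ->
  measurable_fun [set: T'] g ->
  'N[P]_(q%:E)[EFin \o (fun x => g (phi x))] = 'N[Q]_(q%:E)[EFin \o g].
Proof.
move=> mphi PQ mg; rewrite unlock; congr (_ `^ _).
rewrite -(ge0_integral_transfer mphi PQ (measurable_norm_poweR q mg))//.
by move=> y; exact: poweR_ge0.
Qed.

Lemma le_Lnorm d (T : measurableType d) (R : realType)
    (P : {measure set T -> \bar R}) (g h : T -> R) (q : R) :
  (0 < q)%R -> measurable_fun [set: T] g -> measurable_fun [set: T] h ->
  (forall x, `|g x| <= `|h x|)%R ->
  'N[P]_(q%:E)[EFin \o g] <= 'N[P]_(q%:E)[EFin \o h].
Proof.
move=> q0 mg mh gh; rewrite unlock; apply: gt0_ler_poweR.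
- by rewrite invr_ge0 ltW.
- by rewrite in_itv/= leey integral_ge0// => x _; exact: poweR_ge0.
- by rewrite in_itv/= leey integral_ge0// => x _; exact: poweR_ge0.
apply: ge0_le_integral => //.
- by move=> x _; exact: poweR_ge0.
- exact: measurable_norm_poweR.
- exact: measurable_norm_poweR.
move=> x _; rewrite lee_fin ge0_ler_powR//; exact: ltW.
Qed.

(** * Truncation *)

Section clipping.
Context {R : realType}.
Implicit Types (M t u : R).
Local Open Scope ring_scope.

Definition clip M t := Num.max (- M) (Num.min t M).

Lemma clip_cases M t : 0 <= M ->
  [\/ t < - M /\ clip M t = - M, - M <= t <= M /\ clip M t = t |
       M < t /\ clip M t = M].
Proof.
move=> M0; rewrite /clip; have [tM|tM] := leP t M.
  have [tM'|tM'] := leP (- M) t; last by constructor 1.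
  by constructor 2.
by constructor 3; rewrite max_r//; lra.
Qed.

Lemma clip_bound M t : 0 <= M -> `|clip M t| <= M.
Proof.
move=> M0; rewrite ler_norml; apply/andP.
by case: (clip_cases t M0) => -[h ->]; split; lra.
Qed.

Lemma clip_lipschitz M t u : 0 <= M -> `|clip M t - clip M u| <= `|t - u|.
Proof.
move=> M0; rewrite ler_norml; apply/andP.
have h1 := ler_norm (t - u); have h2 := ler_norm (u - t).
rewrite distrC in h2.
by case: (clip_cases t M0) => -[ht ->]; case: (clip_cases u M0) => -[hu ->];
  split; lra.
Qed.

(** The error is zero for |t| <= M. Beyond, it is at most |t| <= |t|^2 / M <= |t|^p / M, because |t|
    >= M >= 1. *)
Lemma clip_error M p t : 1 <= M -> 2 <= p ->
  `|clip M t - t| <= `|t| `^ p / M.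
Proof.
move=> M1 p2; have M0 : 0 < M by lra.
have big : `|clip M t - t| <= `|t| -> M <= `|t| ->
    `|clip M t - t| <= `|t| `^ p / M.
  move=> h tM; apply: (le_trans h); rewrite ler_pdivlMr//.
  have t0 : 0 < `|t| by lra.
  apply: (@le_trans _ _ (`|t| ^+ 2)); first by rewrite expr2 ler_wpM2l.
  by rewrite -(powR_mulrn 2 (normr_ge0 t)) ler_powR//; lra.
case: (clip_cases t (ltW M0)) => -[h e].
- rewrite e in big *; apply: big; rewrite ?(ltr0_norm (_ : t < 0)); try lra.
  by rewrite ger0_norm; lra.
- by rewrite e subrr normr0 divr_ge0 ?powR_ge0// ltW.
- rewrite e in big *; apply: big; rewrite ?(gtr0_norm (_ : 0 < t)); try lra.
  by rewrite ler0_norm; lra.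
Qed.

Lemma measurable_clip d (T : measurableType d) M (g : T -> R) :
  measurable_fun [set: T] g -> measurable_fun [set: T] (fun x => clip M (g x)).
Proof.
move=> mg; apply: measurable_maxr => //.
exact: measurable_minr.
Qed.

End clipping.

(** * Law of the innovations and of their independent copy *)

Section field_law.
Context (disp : measure_display) (T : measurableType disp) (R : realType)
  (P : probability T R) (d : nat).
Local Notation I := 'rV[int]_d.
Local Notation E := (product_space R I).

Lemma measurable_sample_path (Y : I -> {RV P >-> R}) :
  measurable_fun [set: T] (sample_path Y : T -> E).
Proof. by apply: measurable_to_product => u; exact: measurable_funP. Qed.

Variables (eps eps' : I -> {RV P >-> R}).
Hypothesis eps_iid : iid P eps.

Definition field_law : probability E R := push_prob P (measurable_sample_path eps).

Lemma field_law_iid : iid_law (fun B => P (eps 0%R @^-1` B)) field_law.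
Proof.
move=> J B mB; rewrite push_probE.
have [indep ident] := eps_iid.
rewrite (_ : _ @^-1` _ = \bigcap_(i in [set` J]) eps i @^-1` B i).
  by rewrite indep//; apply: eq_bigr => i _; exact: ident.
by apply/seteqP; split=> w h i iJ; exact: h.
Qed.

Hypothesis indep : independent_fields P eps eps'.
Hypothesis law : same_field_law P eps' eps.

Definition sample_pair (w : T) : E * E := (sample_path eps w, sample_path eps' w).

Lemma measurable_sample_pair : measurable_fun [set: T] sample_pair.
Proof. by apply: measurable_fun_pair; exact: measurable_sample_path. Qed.

Lemma sample_pair_law A : measurable A ->
  P (sample_pair @^-1` A) = (field_law \x field_law) A.
Proof.
move=> mA; rewrite -(push_probE P measurable_sample_pair).
apply/esym; apply: product_measure_unique => // B C mB mC.
transitivity (P (sample_path eps @^-1` B `&` sample_path eps' @^-1` C)) => //.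
by rewrite indep// law.
Qed.

End field_law.

Section sphere_series.
Context {R : realType} {d : nat}.
Local Notation I := 'rV[int]_d.

(** [dependence_series] with the coefficients abstracted, so that estimates on the product space can
    be stated with arbitrary majorants. *)
Definition sphere_series (c : R) (dl : I -> \bar R) : \bar R :=
  \sum_(0 <= j <oo) (((4 * j + 4)%N%:R : R) `^ c)%:E *
    (\sum_(i \in [set i : I | supnorm i = j]) dl i ^+ 2) `^ 2^-1.

Lemma fsbig_sphere (dl : I -> \bar R) j :
  \sum_(i \in [set i : I | supnorm i = j]) dl i ^+ 2 =
  \sum_(i <- sphere_seq j) dl i ^+ 2.
Proof. by rewrite fsbig_finite//; exact: finite_sphere. Qed.

Lemma sphere_series_term_ge0 (c : R) (dl : I -> \bar R) j :
  0 <= (((4 * j + 4)%N%:R : R) `^ c)%:E *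
    (\sum_(i \in [set i : I | supnorm i = j]) dl i ^+ 2) `^ 2^-1.
Proof. by rewrite mule_ge0 ?poweR_ge0// lee_fin powR_ge0. Qed.

Lemma sphere_series_ge0 (c : R) (dl : I -> \bar R) : 0 <= sphere_series c dl.
Proof. by apply: nneseries_ge0 => j _ _; exact: sphere_series_term_ge0. Qed.

Lemma sphere_series_partial (c : R) (dl : I -> \bar R) (dr : I -> R) N :
  (forall i, (0 <= dr i)%R) -> (forall i, (dr i)%:E <= dl i) ->
  (\sum_(0 <= j < N) ((4 * j + 4)%N%:R `^ c *
     (\sum_(u <- sphere_seq j) dr u ^+ 2) `^ 2^-1)%R)%R%:E <=
  sphere_series c dl.
Proof.
move=> dr0 drdl; apply: le_trans (nneseries_lim_ge N _); last first.
  by move=> j _ _; exact: sphere_series_term_ge0.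
rewrite -sumEFin; apply: lee_sum => j _.
rewrite EFinM; apply: lee_wpmul2l; first by rewrite lee_fin powR_ge0.
have s0 : (0 <= \sum_(u <- sphere_seq j) dr u ^+ 2)%R.
  by apply: sumr_ge0 => u _; exact: sqr_ge0.
have sle : (\sum_(u <- sphere_seq j) dr u ^+ 2)%R%:E <=
    \sum_(i <- sphere_seq j) dl i ^+ 2.
  rewrite -sumEFin; apply: lee_sum => u _.
  by rewrite expr2 EFinM expe2; apply: lee_pmul; rewrite ?lee_fin.
rewrite fsbig_sphere -poweR_EFin; apply: gt0_ler_poweR => //.
- by rewrite in_itv/= leey lee_fin s0.
- by rewrite in_itv/= leey andbT (le_trans _ sle)// lee_fin.
Qed.

End sphere_series.

(** * Finite weighted sums of an unbounded field *)

Section finite_sums.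
Context {R : realType} {d : nat}.
Local Notation I := 'rV[int]_d.
Local Notation E := (product_space R I).
Variables (mu : set R -> \bar R) (nu : probability E R).
Hypothesis inu : iid_law mu nu.
Variable f : E -> R.
Hypothesis mf : measurable_fun [set: E] f.

Definition shift_pair (i : I) (z : E * E) : E * E := (shift i z.1, shift i z.2).

Let shift_side (i : I) (k : (I + I)%type) : (I + I)%type :=
  match k with inl u => inl (i - u)%R | inr u => inr (i - u)%R end.

Lemma measurable_shift_pair i : measurable_fun [set: E * E] (shift_pair i).
Proof.
apply: measurable_fun_pair.
  exact: (measurableT_comp (measurable_shift i) measurable_fst).
exact: (measurableT_comp (measurable_shift i) measurable_snd).
Qed.

Lemma shift_pair_law i A : measurable A ->
  (nu \x nu) (shift_pair i @^-1` A) = (nu \x nu) A.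
Proof.
move=> mA; rewrite -[RHS](@join_preserve2 _ _ _ _ inu (shift_side i) _ _ mA)//.
by move=> [u|u] [v|v] //= [] /addrI /oppr_inj ->.
Qed.

Lemma measurable_resample (g : E -> R) v : measurable_fun [set: E] g ->
  measurable_fun [set: E * E] (resample g v).
Proof.
move=> mg; apply: measurable_funB.
  exact: (measurableT_comp mg measurable_fst).
exact: (measurableT_comp mg (measurable_merge _)).
Qed.

(** Since i - u = 0 exactly when u = i, resampling coordinate i after the shift is resampling the
    origin before it: this is X_i minus its coupled version. *)
Lemma resample_shift i z : resample f i (shift_pair i z) =
  (f (shift i z.1) - f (shift i (merge (predC1 0%R) z.1 z.2)))%R.
Proof.
rewrite /resample /=; congr (_ - f _)%R; apply/funext => u.
by rewrite /merge /shift /reindex /= subr_eq0 eq_sym.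
Qed.

Lemma L1_shift_sum (s : seq I) (a : I -> R) (h : E -> R) :
  measurable_fun [set: E] h ->
  \int[nu]_x (`|\sum_(i <- s) a i * h (shift i x)|%R)%:E <=
  (\sum_(i <- s) `|a i|)%R%:E * \int[nu]_x (`|h x|%R)%:E.
Proof.
move=> mh.
have mn (g : E -> R) : measurable_fun setT g ->
    measurable_fun setT (fun x => (`|g x|%R)%:E).
  by move=> mg; apply/measurable_EFinP; exact: measurableT_comp.
have mhi i : measurable_fun setT (fun x => h (shift i x)).
  exact: (measurableT_comp mh (measurable_shift i)).
have mS (s' : seq I) :
    measurable_fun setT (fun x => (\sum_(i <- s') a i * h (shift i x))%R).
  by apply: measurable_sum => i; apply: measurable_funM.
elim: s => [|i s IH].
  under eq_integral do rewrite big_nil normr0.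
  by rewrite integral0 big_nil mul0e.
have hE : \int[nu]_x (`|a i * h (shift i x)|%R)%:E =
    (`|a i|)%R%:E * \int[nu]_x (`|h x|%R)%:E.
  under eq_integral do rewrite normrM EFinM.
  rewrite ge0_integralZl_EFin//; last exact: mn.
  congr (_ * _); apply: (ge0_integral_transfer (measurable_shift i)) => //.
    by move=> A mA; exact: (shift_law inu).
  exact: mn.
rewrite big_cons EFinD ge0_muleDl ?lee_fin ?sumr_ge0// -hE.
apply: le_trans (leeD (lexx _) IH).
rewrite -ge0_integralD//; last 2 first.
- by apply: mn; exact: measurable_funM.
- exact: mn.
apply: ge0_le_integral => //.
- exact: mn.
- by apply: emeasurable_funD; apply: mn => //; exact: measurable_funM.
by move=> x _; rewrite big_cons -EFinD lee_fin ler_normD.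
Qed.

Variable p : R.
Hypothesis p2 : (2 <= p)%R.
Hypothesis f_moment : \int[nu]_x ((`|f x| `^ p)%R)%:E < +oo.
Hypothesis f_centered : \int[nu]_x (f x)%:E = 0.

Lemma f_integrable : nu.-integrable setT (EFin \o f).
Proof.
apply/integrableP; split; first exact/measurable_EFinP.
apply: (@le_lt_trans _ _ (\int[nu]_x (1 + ((`|f x| `^ p)%R)%:E))).
  apply: ge0_le_integral => //.
  - by apply/measurable_EFinP; exact: measurableT_comp.
  - apply: emeasurable_funD => //; apply/measurable_EFinP.
    by apply: (measurableT_comp (measurable_powR _)); exact: measurableT_comp.
  move=> x _; rewrite /= -EFinD lee_fin.
  have h0 := powR_ge0 `|f x| p.
  have [h|h] := leP `|f x|%R 1%R; first lra.
  have p1 : (1 <= p)%R by have := p2; lra.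
  have := powR_tangent p1 (normr_ge0 (f x)) (@ler01 R).
  have : (0 <= (p - 1) * (`|f x| - 1))%R by apply: mulr_ge0; lra.
  by rewrite !powR1 /= mulr1 => h1 h2; lra.
rewrite ge0_integralD//.
- by rewrite integral_cst// mul1e lte_add_pinfty// -ge0_fin_numE ?fin_num_measure.
- apply/measurable_EFinP.
  by apply: (measurableT_comp (measurable_powR _)); exact: measurableT_comp.
Qed.

Definition clipped M (x : E) := clip M (f x).

Lemma bm_clipped M : (0 <= M)%R -> bounded_measurable (clipped M).
Proof.
move=> M0; split; first exact: measurable_clip.
by exists M => x; exact: clip_bound.
Qed.

Lemma clipped_approx e : (0 < e)%R -> exists M, [/\ (1 <= M)%R,
  \int[nu]_x (`|clipped M x - f x|%R)%:E <= e%:E &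
  (`|\int[nu]_x clipped M x| <= e)%R].
Proof.
move=> e0; have := f_moment; set D := \int[nu]_x ((`|f x| `^ p)%R)%:E => Dy.
have D0 : 0 <= D by apply: integral_ge0 => x _; rewrite lee_fin powR_ge0.
have Dfin : D \is a fin_num by rewrite ge0_fin_numE.
(* By [clip_error] the L^1 error is at most D / M, and M is chosen so that this is at most e. The
   same error bounds the mean of the clipped function, because f is centered. *)
pose M := (1 + fine D / e)%R.
have De : (0 <= fine D / e)%R by rewrite divr_ge0 ?fine_ge0// ltW.
have M1 : (1 <= M)%R by rewrite lerDl.
have M0 : (0 < M)%R by rewrite (lt_le_trans ltr01).
have mpow : measurable_fun setT (fun x => ((`|f x| `^ p)%R)%:E).
  apply/measurable_EFinP.
  by apply: (measurableT_comp (measurable_powR _)); exact: measurableT_comp.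
have mcf : measurable_fun setT (fun x => (clipped M x - f x)%R).
  by apply: measurable_funB => //; exact: measurable_clip.
have h : \int[nu]_x (`|clipped M x - f x|%R)%:E <= e%:E.
  apply: (@le_trans _ _ (\int[nu]_x ((M^-1)%:E * ((`|f x| `^ p)%R)%:E))).
    apply: ge0_le_integral => //.
    - by apply/measurable_EFinP; exact: measurableT_comp.
    - exact: measurable_funeM.
    move=> x _; rewrite -EFinM lee_fin mulrC; exact: clip_error.
  rewrite ge0_integralZl_EFin//; last by rewrite invr_ge0 ltW.
  rewrite -/D -(fineK Dfin) -EFinM lee_fin mulrC ler_pdivrMr//.
  by rewrite /M mulrDr mulr1 mulrCA divff ?gt_eqF// mulr1 lerDr ltW.
exists M; split => //.
have ic := bm_integrable nu (bm_clipped (ltW M0)).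
have icf := integrableB measurableT ic f_integrable.
have -> : (\int[nu]_x clipped M x = \int[nu]_x (clipped M x - f x))%R.
  rewrite RintegralB//; last exact: f_integrable.
  by rewrite [X in (_ - X)%R]/Rintegral f_centered subr0.
rewrite -lee_fin EFin_normr_Rintegral//.
apply: le_trans (le_abse_integral _ _ _) _ => //.
exact/measurable_EFinP.
Qed.

(** f is replaced by a bounded centered function h of finitely many sites, to which the layer bounds
    apply; semicontinuity returns to f. Clipping is 1-Lipschitz, so the resampling norms of f, and
    any majorants of them, still dominate. *)
Lemma finite_sum_norm (hd : (1 <= d)%N) (s : seq I) (a : I -> R)
    (dl2 dlp : I -> \bar R) : uniq s ->
  (forall i, 'N[(nu \x nu)]_(2%:E)[EFin \o resample f i] <= dl2 i) ->
  (forall i, 'N[(nu \x nu)]_(p%:E)[EFin \o resample f i] <= dlp i) ->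
  'N[nu]_(p%:E)[EFin \o (fun x => \sum_(i <- s) a i * f (shift i x))%R] <=
  (Num.sqrt 2 * (29 / 2 * p / ln p))%R%:E *
    ((\sum_(i <- s) `|a i| `^ 2) `^ 2^-1)%R%:E *
    sphere_series (d%:R / 2)%R dl2 +
  (Num.sqrt 2 * (29 / 2 * p / ln p) * Num.sqrt (p - 1))%R%:E *
    ((\sum_(i <- s) `|a i| `^ p) `^ p^-1)%R%:E *
    sphere_series (d%:R * (1 - 1 / p))%R dlp.
Proof.
move=> us hdl2 hdlp; have p2' := p2; have p0 : (0 < p)%R by lra.
have L0 : (0 < ln p)%R by rewrite ln_gt0//; lra.
apply: Lnorm_lower_semicontinuous.
- lra.
- apply: measurable_sum => i; apply: measurable_funM => //.
  exact: (measurableT_comp mf (measurable_shift i)).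
move=> e e0.
set A := (\sum_(i <- s) `|a i|)%R.
have A0 : (0 <= A)%R by exact: sumr_ge0.
have A1 : (0 < 3 * (A + 1))%R by rewrite mulr_gt0//; lra.
(* Three errors of size [eta] occur: clipping, conditioning on a ball, and recentering. A + 1 keeps
   the divisor positive when all weights vanish. *)
pose eta := (e / (3 * (A + 1)))%R.
have eta0 : (0 < eta)%R by rewrite divr_gt0.
have [M [M1 cM iM]] := clipped_approx eta0.
have M0 : (0 <= M)%R by lra.
have bM := bm_clipped M0.
have [N hN] := cexp_approx inu bM eta0.
set c := (\int[nu]_x clipped M x)%R in iM.
(* The layers telescope to the conditional expectation minus the mean; clipping may have shifted the
   mean away from 0, so it is subtracted. *)
pose h x := (cexp nu (ball_pred N) (clipped M) x - c)%R.
have bh : bounded_measurable h.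
  by apply: bmB; [exact: bm_cexp|exact: bm_cst].
pose g x := (\sum_(i <- s) a i * h (shift i x))%R.
have bhi i : bounded_measurable (fun x => h (shift i x)).
  exact: (bm_comp (measurable_shift i) bh).
have bg : bounded_measurable g by apply: bm_sum => i; exact: bmZ.
exists g; split; first by case: bg.
- rewrite (Lnorm_norm_p nu (ltW p0) bg).
  have gE : g = fun x => (\sum_(0 <= j < N) \sum_(i <- s)
      a i * layer nu (clipped M) j (shift i x))%R.
    apply/funext => x; rewrite exchange_big/=; apply: eq_bigr => i _.
    by rewrite -mulr_sumr cexp_telescope.
  have bl j : bounded_measurable (fun x => (\sum_(i <- s)
      a i * layer nu (clipped M) j (shift i x))%R).
    apply: bm_sum => i; apply: bmZ.
    exact: (bm_comp (measurable_shift i) (bm_layer nu bM j)).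
  have p1 : (1 <= p)%R by lra.
  have n1 := norm_p_sum nu (index_iota 0 N) p1 bl.
  rewrite -gE in n1.
  pose w2 j : R := ((4 * j + 4)%N%:R `^ (d%:R / 2) *
    sphere_delta nu (clipped M) 2 j)%R.
  pose wp j : R := ((4 * j + 4)%N%:R `^ (d%:R * (1 - 1 / p)) *
    sphere_delta nu (clipped M) p j)%R.
  have key q (dl : I -> \bar R) c' : (2 <= q)%R ->
      (forall i, 'N[(nu \x nu)]_(q%:E)[EFin \o resample f i] <= dl i) ->
      (\sum_(0 <= j < N) ((4 * j + 4)%N%:R `^ c' *
         sphere_delta nu (clipped M) q j)%R)%R%:E <= sphere_series c' dl.
    move=> q2 hdl; apply: sphere_series_partial => i; first exact: norm_p_ge0.
    have q0 : (0 < q)%R by lra.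
    apply: le_trans (hdl i); rewrite -Lnorm_norm_p ?(ltW q0)//; last exact: bm_resample.
    apply: le_Lnorm => //; [|exact: measurable_resample|].
      by apply: measurable_resample; case: bM.
    by move=> z; exact: clip_lipschitz.
  have k2 := key 2%R dl2 (d%:R / 2)%R (lexx _) hdl2.
  have kp := key p dlp (d%:R * (1 - 1 / p))%R p2 hdlp.
  have K0 : (0 <= Num.sqrt 2 * (29 / 2 * p / ln p) :> R)%R.
    by rewrite mulr_ge0// divr_ge0 ?mulr_ge0// ltW.
  set K := (Num.sqrt 2 * _)%R in K0 *.
  have sqrE : (\sum_(i <- s) `|a i| `^ 2 = \sum_(i <- s) a i ^+ 2)%R.
    by apply: eq_bigr => i _; rewrite (powR_mulrn 2)// real_normK ?num_real.
  have sumE (c1 c2 : R) : (c1 * \sum_(0 <= j < N) w2 j +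
      c2 * \sum_(0 <= j < N) wp j = \sum_(0 <= j < N) (c1 * w2 j + c2 * wp j))%R.
    by rewrite big_split/= !mulr_sumr.
  apply: (@le_trans _ _ (K * (\sum_(i <- s) `|a i| `^ 2) `^ 2^-1 *
      (\sum_(0 <= j < N) w2 j) +
      K * Num.sqrt (p - 1) * (\sum_(i <- s) `|a i| `^ p) `^ p^-1 *
      (\sum_(0 <= j < N) wp j))%R%:E).
    rewrite lee_fin; apply: (le_trans n1).
    rewrite sumE; apply: ler_sum => j _.
    by rewrite sqrE; exact: (level_bound inu bM a j hd p2 us).
  rewrite EFinD !EFinM; apply: leeD; apply: lee_wpmul2l => //.
  - by rewrite mule_ge0// lee_fin powR_ge0.
  - by rewrite mule_ge0 ?lee_fin ?powR_ge0// mulr_ge0.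
have mhf : measurable_fun setT (fun x => (h x - f x)%R).
  by apply: measurable_funB => //; case: bh.
have -> : \int[nu]_x (`|g x - \sum_(i <- s) a i * f (shift i x)|%R)%:E =
    \int[nu]_x (`|\sum_(i <- s) a i * (h (shift i x) - f (shift i x))|%R)%:E.
  apply: eq_integral => x _; rewrite /g -sumrB; congr (`|_|%R)%:E.
  by apply: eq_bigr => i _; rewrite -mulrBr.
apply: le_trans (L1_shift_sum s a mhf) _; rewrite -/A.
suff hf : \int[nu]_x (`|h x - f x|%R)%:E <= (3 * eta)%R%:E.
  apply: le_trans (lee_wpmul2l _ hf) _; first by rewrite lee_fin.
  rewrite -EFinM lee_fin /eta.
  have -> : (A * (3 * (e / (3 * (A + 1)))) = e * (A / (A + 1)))%R.
    by field; rewrite gt_eqF//; lra.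
  by rewrite ler_piMr ?ltW// ltr_pdivrMr; lra.
pose u x := (clipped M x - cexp nu (ball_pred N) (clipped M) x)%R.
have bu : bounded_measurable u by apply: bmB => //; exact: bm_cexp.
have mcf : measurable_fun setT (fun x => (clipped M x - f x)%R).
  by apply: measurable_funB => //; case: bM.
have mnu : measurable_fun setT (fun x => (`|u x|%R)%:E).
  by apply/measurable_EFinP; apply: measurableT_comp => //; case: bu.
have mncf : measurable_fun setT (fun x => (`|clipped M x - f x|%R)%:E).
  by apply/measurable_EFinP; exact: measurableT_comp.
apply: (@le_trans _ _ (\int[nu]_x ((`|u x|%R)%:E +
    ((`|clipped M x - f x|%R)%:E + (`|c|%R)%:E)))).
  apply: ge0_le_integral => //.
  - by apply/measurable_EFinP; exact: measurableT_comp.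
  - by apply: emeasurable_funD => //; exact: emeasurable_funD.
  move=> x _; rewrite -!EFinD lee_fin.
  have -> : (h x - f x = - u x + ((clipped M x - f x) - c))%R.
    by rewrite /h /u; ring.
  apply: le_trans (ler_normD _ _) _; rewrite normrN lerD2l.
  exact: ler_normB.
rewrite ge0_integralD//; last 2 first.
- by move=> x _; exact: adde_ge0.
- exact: emeasurable_funD.
rewrite ge0_integralD// integral_cst//.
rewrite [X in _ + (_ + X)](_ : _ = (`|c|%R)%:E); last first.
  by rewrite [X in _ * X](_ : _ = 1) ?mule1//; exact: probability_setT.
have -> : (3 * eta = eta + (eta + eta))%R by ring.
rewrite !EFinD; apply: leeD; last by apply: leeD; rewrite ?lee_fin.
by rewrite (integral_EFin nu (bm_norm bu)) lee_fin; exact: hN.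
Qed.

End finite_sums.

Lemma integrable_transfer d d' (T : measurableType d) (T' : measurableType d')
    (R : realType) (P : {measure set T -> \bar R})
    (Q : {measure set T' -> \bar R}) (phi : T -> T') (g : T' -> \bar R) :
  measurable_fun [set: T] phi ->
  (forall A, measurable A -> P (phi @^-1` A) = Q A) ->
  Q.-integrable [set: T'] g ->
  P.-integrable [set: T] (g \o phi) /\
  \int[P]_x g (phi x) = \int[Q]_y g y.
Proof.
move=> mphi PQ /integrableP[mg gy].
have ig : P.-integrable [set: T] (g \o phi).
  apply/integrableP; split; first exact: measurableT_comp.
  rewrite (ge0_integral_transfer (h := fun y => `|g y|) mphi PQ)//.
  exact: measurableT_comp.
split=> //; have QP A : measurable A -> A `<=` [set: T'] -> Q A = pushforward P phi A.
  by move=> mA _; rewrite /pushforward PQ.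
rewrite (eq_measure_integral (pushforward P phi) QP).
by rewrite [RHS]integral_pushforward ?preimage_setT.
Qed.

(** * Weights in l^q *)

Section lq_norm.
Context {R : realType} {d : nat}.
Local Notation I := 'rV[int]_d.
Implicit Types (a : I -> R) (s : seq I) (q : R).

Lemma sum_le_esum a q s : uniq s ->
  (\sum_(i <- s) `|a i| `^ q)%R%:E <=
  \esum_(i in [set: I]) (`|a i| `^ q)%R%:E.
Proof.
move=> us; apply: esum_ge; exists [set` s].
  by split=> //; exact: finite_seq.
by rewrite -sumEFin fsbig_seq.
Qed.

Lemma finite_le_lq_norm a q s : (0 < q)%R -> uniq s ->
  ((\sum_(i <- s) `|a i| `^ q) `^ q^-1)%R%:E <= lq_norm q a.
Proof.
move=> q0 us; rewrite /lq_norm -poweR_EFin; apply: gt0_ler_poweR.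
- by rewrite invr_ge0 ltW.
- rewrite in_itv/= leey andbT lee_fin.
  by apply: sumr_ge0 => i _; exact: powR_ge0.
- rewrite in_itv/= leey andbT; apply: esum_ge0 => i _.
  by rewrite lee_fin powR_ge0.
exact: sum_le_esum.
Qed.

Lemma lq_norm_ge0 a q : 0 <= lq_norm q a.
Proof. exact: poweR_ge0. Qed.

Lemma lq_norm_eq0 a q i : (0 < q)%R -> lq_norm q a = 0 -> a i = 0%R.
Proof.
move=> q0 a0; have := @finite_le_lq_norm a q [:: i] q0 isT.
rewrite a0 big_seq1 lee_fin -powRrM mulfV ?gt_eqF// powRr1// normr_le0.
by move/eqP.
Qed.

(** Take a finite set whose sum is within e of the supremum: disjoint finite sets can add at most e,
    and everything beyond its largest norm is disjoint from it. *)
Lemma lq_tail a q e : (0 < q)%R -> in_lq q a -> (0 < e)%R ->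
  exists k0, forall s, uniq s -> {in s, forall i, (k0 < supnorm i)%N} ->
    (\sum_(i <- s) `|a i| `^ q <= e)%R.
Proof.
move=> q0 ha e0.
set V := \esum_(i in [set: I]) (`|a i| `^ q)%R%:E.
have V0 : 0 <= V by apply: esum_ge0 => i _; rewrite lee_fin powR_ge0.
have Vfin : V \is a fin_num.
  rewrite ge0_fin_numE//; apply: (@lty_poweRy _ _ q^-1) => //.
  by rewrite invr_eq0 gt_eqF.
have [_ [F [finF _] <-] VF] := ub_ereal_sup_adherent e0 Vfin.
rewrite fsbig_finite// in VF.
set t := enum_fset (fset_set F) in VF.
exists (\max_(i <- t) supnorm i)%N => s us sF.
have ts : uniq (t ++ s).
  rewrite cat_uniq us fset_uniq andbT; apply/hasPn => i si.
  apply/negP => it; have := sF i si; rewrite ltnNge.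
  by rewrite (leq_bigmax_seq (F := @supnorm d) i).
have := sum_le_esum a q ts; rewrite -/V big_cat/= EFinD => h.
rewrite -lee_fin -(@leeD2lE _ (\sum_(i <- t) `|a i| `^ q)%R%:E)//.
apply: (le_trans h); rewrite -leeBlDr//.
by rewrite -sumEFin; exact: ltW.
Qed.

End lq_norm.

Lemma Lnorm1_le_Lnorm2 d (T : measurableType d) (R : realType)
    (P : probability T R) (g : T -> R) : measurable_fun [set: T] g ->
  \int[P]_x (`|g x|%R)%:E <= 'N[P]_(2%:E)[EFin \o g].
Proof.
move=> mg; have := @hoelder _ T R P g (cst 1%R) 2 2 mg (measurable_cst _).
rewrite Lnorm_cst1 [X in X `^ _](_ : _ = 1); last exact: probability_setT.
rewrite poweR1r mule1 Lnorm1.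
under eq_integral do rewrite /= mulr1.
by apply; [by []|by []|field].
Qed.

(** * Return from the product space to the random field *)

Section bernoulli_shift_field.
Context (R : realType) (d : nat)
  (disp : measure_display) (T : measurableType disp) (P : probability T R)
  (eps eps' : 'rV[int]_d -> {RV P >-> R}).
Hypotheses (eps_iid : iid P eps)
  (eps_eps'_indep : independent_fields P eps eps')
  (eps_eps'_law : same_field_law P eps' eps).
Variable f : ('rV[int]_d -> R) -> R.
Hypothesis mf : measurable_fun [set: product_space R 'rV[int]_d]
  (f : product_space R 'rV[int]_d -> R).
Local Notation I := 'rV[int]_d.
Local Notation E := (product_space R I).
Local Notation nu := (field_law eps).
Local Notation X := (bernoulli_shift f eps).
Let inu := field_law_iid eps_iid.
Let mpath := measurable_sample_path eps.

Let path_law (A : set E) : measurable A -> P (sample_path eps @^-1` A) = nu A.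
Proof. by []. Qed.

(** Two measure-preserving transfers: along the pair of sample paths, whose law is nu x nu, and
    along the shift of both copies by i. *)
Lemma physical_dependenceE i q : physical_dependence P f eps eps' i q =
  'N[(nu \x nu)]_(q%:E)[EFin \o resample (f : E -> R) i].
Proof.
rewrite -(Lnorm_transfer q (measurable_shift_pair i)
  (fun A => @shift_pair_law _ _ _ _ inu i A) (measurable_resample i mf)).
have mg : measurable_fun setT
    (fun z : E * E => resample (f : E -> R) i (shift_pair i z)).
  exact: (measurableT_comp (measurable_resample i mf) (measurable_shift_pair i)).
rewrite -(Lnorm_transfer q (measurable_sample_pair eps eps')
  (fun A => @sample_pair_law _ _ _ _ _ _ _ eps_eps'_indep eps_eps'_law A) mg).
apply: eq_Lnorm => w /=; rewrite resample_shift /bernoulli_shift.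
congr (_ - f _)%:E; apply/funext => u.
rewrite /shift /reindex /merge /replace_origin /=.
by case: (eqVneq (i - u)%R 0%R) => [->|].
Qed.

Lemma Lnorm_shift_sum (s : seq I) (a : I -> R) q :
  'N[P]_(q%:E)[EFin \o (fun w => \sum_(i <- s) a i * X i w)%R] =
  'N[nu]_(q%:E)[EFin \o (fun x => \sum_(i <- s) a i * f (shift i x))%R].
Proof.
have mS : measurable_fun [set: E] (fun x => \sum_(i <- s) a i * f (shift i x))%R.
  apply: measurable_sum => i; apply: measurable_funM => //.
  exact: (measurableT_comp mf (measurable_shift i)).
by rewrite -(Lnorm_transfer q mpath path_law mS).
Qed.

Lemma measurable_X i : measurable_fun setT (X i).
Proof.
exact: (measurableT_comp mf (measurableT_comp (measurable_shift i) mpath)).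
Qed.

Lemma measurable_X_sum (s : seq I) (a : I -> R) :
  measurable_fun setT (fun w => \sum_(i <- s) a i * X i w)%R.
Proof.
by apply: measurable_sum => i; apply: measurable_funM => //; exact: measurable_X.
Qed.

Lemma shift_sample_law i (A : set E) : measurable A ->
  P ((fun w => shift i (sample_path eps w)) @^-1` A) = nu A.
Proof. by move=> mA; rewrite -(shift_law inu i mA). Qed.

Lemma measurable_shift_sample i :
  measurable_fun setT (fun w => shift i (sample_path eps w) : E).
Proof. exact: (measurableT_comp (measurable_shift i) mpath). Qed.

Lemma measurable_f_powR q :
  measurable_fun [set: E] (fun x : E => ((`|f x| `^ q)%R)%:E).
Proof.
apply/measurable_EFinP.
by apply: (measurableT_comp (measurable_powR _)); exact: measurableT_comp.
Qed.

Lemma moment_transfer q :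
  'E_P[fun w => (`|X 0%R w| `^ q)%R] = \int[nu]_x ((`|f x| `^ q)%R)%:E.
Proof.
by rewrite unlock -(ge0_integral_transfer (measurable_shift_sample 0%R)
  (@shift_sample_law 0%R) (measurable_f_powR q))//.
Qed.

Definition box_seq (k : nat) : seq I :=
  enum_fset (fset_set [set i : I | (supnorm i <= k)%N]).

Lemma mem_box_seq k i : (i \in box_seq k) = (supnorm i <= k)%N.
Proof.
rewrite /box_seq in_fset_set; last exact: finite_box.
by apply/idP/idP; rewrite inE.
Qed.

Lemma box_sum (F : I -> R) k :
  (\sum_(i \in [set i : I | (supnorm i <= k)%N]) F i =
   \sum_(i <- box_seq k) F i)%R.
Proof. by rewrite fsbig_finite//; exact: finite_box. Qed.

Lemma box_sumB (F : I -> R) m n : (m <= n)%N ->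
  (\sum_(i <- box_seq n) F i - \sum_(i <- box_seq m) F i =
   \sum_(i <- [seq i <- box_seq n | (m < supnorm i)%N]) F i)%R.
Proof.
move=> mn; rewrite (bigID (fun i => (m < supnorm i)%N))/= -[RHS]big_filter.
rewrite [X in (X - _)%R](_ : _ = \sum_(i <- [seq i <- box_seq n | (m < supnorm i)%N]) F i
    + \sum_(i <- box_seq m) F i)%R; first by rewrite addrK big_filter.
rewrite big_filter; congr (_ + _)%R; rewrite -big_filter; apply: perm_big.
apply: uniq_perm; [exact/filter_uniq/fset_uniq|exact: fset_uniq|].
move=> i; rewrite mem_filter !mem_box_seq -leqNgt.
by case: leqP => //= im; rewrite (leq_trans im).
Qed.

End bernoulli_shift_field.

(** * Norm bound and existence of the sum over the whole lattice *)

Theorem corollary1p5 (R : realType) (d : nat) (hd : (1 <= d)%N)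
  (p : R) (hp : (2 <= p)%R)
  (disp : measure_display) (T : measurableType disp) (P : probability T R)
  (eps eps' : 'rV[int]_d -> {RV P >-> R})
  (eps_iid : iid P eps)
  (eps'_iid : iid P eps')
  (eps_eps'_indep : independent_fields P eps eps')
  (eps_eps'_law : same_field_law P eps' eps)
  (f : ('rV[int]_d -> R) -> R)
  (mf : measurable_fun [set: product_space R 'rV[int]_d]
          (f : product_space R 'rV[int]_d -> R))
  (X_moment : forall j : 'rV[int]_d,
     'E_P[fun w => (`|bernoulli_shift f eps j w| `^ p)%R] < +oo)
  (X_centered : forall j : 'rV[int]_d, 'E_P[bernoulli_shift f eps j] = 0)
  (a : 'rV[int]_d -> R) (ha : in_lq 2 a) :
  field_sum_norm_le P (fun i w => a i * bernoulli_shift f eps i w)%R p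
    ((Num.sqrt 2 * (29 / 2 * p / ln p))%R%:E
       * lq_norm 2 a
       * dependence_series P f eps eps' (d%:R / 2)%R 2
     + (Num.sqrt 2 * (29 / 2 * p / ln p) * Num.sqrt (p - 1))%R%:E
       * lq_norm p a
       * dependence_series P f eps eps' (d%:R * (1 - 1 / p))%R p).
Proof.
have inu := field_law_iid eps_iid; set nu := field_law eps in inu.
pose X := bernoulli_shift f eps.
have p0 : (0 < p)%R by lra.
have L0 : (0 < ln p)%R by rewrite ln_gt0//; lra.
have fp : \int[nu]_x ((`|f x| `^ p)%R)%:E < +oo.
  by rewrite -(moment_transfer eps_iid mf).
have fint := f_integrable mf hp fp.
have f0 : \int[nu]_x (f x)%:E = 0.
  have [_ <-] := integrable_transfer (measurable_shift_sample eps 0%R)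
    (fun A => @shift_sample_law _ _ _ _ _ _ eps_iid 0%R A) fint.
  by have := X_centered 0%R; rewrite unlock.
pose dl q (i : 'rV[int]_d) := physical_dependence P f eps eps' i q.
have dlE q i : 'N[(nu \x nu)]_(q%:E)[EFin \o resample (f : product_space R _ -> R) i]
    <= dl q i.
  by rewrite /dl (physical_dependenceE eps_iid eps_eps'_indep eps_eps'_law mf).
set D2 := dependence_series P f eps eps' (d%:R / 2)%R 2.
set Dp := dependence_series P f eps eps' (d%:R * (1 - 1 / p))%R p.
have D20 : 0 <= D2 by exact: sphere_series_ge0.
have Dp0 : 0 <= Dp by exact: sphere_series_ge0.
set K := (Num.sqrt 2 * (29 / 2 * p / ln p))%R.
have K0 : (0 < K)%R.
  by rewrite mulr_gt0 ?sqrtr_gt0// divr_gt0// mulr_gt0.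
have sum_norm s : uniq s ->
    'N[P]_(p%:E)[EFin \o (fun w => \sum_(i <- s) a i * X i w)%R] <=
    K%:E * lq_norm 2 a * D2 + (K * Num.sqrt (p - 1))%R%:E * lq_norm p a * Dp.
  move=> us; rewrite (Lnorm_shift_sum _ mf).
  apply: le_trans (finite_sum_norm inu mf hp fp f0 hd a us (dlE 2%R) (dlE p)) _.
  have Kp : (0 <= K * Num.sqrt (p - 1))%R by rewrite mulr_ge0// ltW.
  apply: leeD.
    apply: lee_wpmul2r => //; apply: lee_wpmul2l; first by rewrite lee_fin ltW.
    exact: finite_le_lq_norm.
  apply: lee_wpmul2r => //; apply: lee_wpmul2l; first by rewrite lee_fin.
  exact: finite_le_lq_norm.
have mS s : measurable_fun setT (fun w => \sum_(i <- s) a i * X i w)%R.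
  exact: measurable_X_sum.
(* Norm bound: each box sum satisfies it by [sum_norm], and it survives the L^1 limit by lower
   semicontinuity. *)
split; last first.
  move=> S [/Lfun1_integrable iS cS].
  have {}mS' : measurable_fun setT S.
    by apply/measurable_EFinP; exact: measurable_int iS.
  apply: Lnorm_lower_semicontinuous => //; first by lra.
  move=> e e0.
  have [k Hk] := (ereal_cvg0P (fun k => Lnorm_ge0 _ _ _)).1 cS e e0.
  exists (fun w => \sum_(i <- box_seq d k) a i * X i w)%R; split => //.
    by apply: sum_norm; exact: fset_uniq.
  have := Hk k (leqnn k); rewrite Lnorm1; apply: le_trans.
  rewrite le_eqVlt; apply/orP; left; apply/eqP; apply: eq_integral => w _.
  by rewrite /= box_sum.
move=> by_.
(* Existence of the sum is proved at exponent 2, whatever p is, so the second moment of f is bounded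
   by 1 plus the p-th one. *)
have fp2 : \int[nu]_x ((`|f x| `^ 2)%R)%:E < +oo.
  apply: (@le_lt_trans _ _ (\int[nu]_x (1 + ((`|f x| `^ p)%R)%:E))).
    apply: ge0_le_integral => //.
    - exact: measurable_f_powR.
    - by apply: emeasurable_funD => //; exact: measurable_f_powR.
    move=> x _; rewrite -EFinD lee_fin.
    have [h|h] := leP `|f x|%R 1%R.
      apply: (@le_trans _ _ 1%R); last by rewrite lerDl powR_ge0.
      by rewrite (@powR_mulrn _ _ 2)// exprn_ile1.
    by apply: ler_wpDl => //; apply: ler_powR => //; exact: ltW.
  rewrite ge0_integralD//; last exact: measurable_f_powR.
  by rewrite integral_cst// mul1e lte_add_pinfty// -ge0_fin_numE ?fin_num_measure.
(* A bound linear in the l^2 norm of the weights: at exponent 2 both series in [finite_sum_norm]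
   coincide with [D2], as d (1 - 1/2) = d / 2. *)
have [C [C0 HC]] : exists C : R, (0 <= C)%R /\ forall s, uniq s ->
    \int[P]_w (`|\sum_(i <- s) a i * X i w|%R)%:E <=
    (C * (\sum_(i <- s) `|a i| `^ 2) `^ 2^-1)%R%:E.
  (* If [D2] is infinite, finiteness of the right-hand side forces a = 0 through the convention 0 *
     oo = 0, and C = 0 works. *)
  have [D2y|D2y] := eqVneq D2 +oo.
    have a0 : lq_norm 2 a = 0.
      apply/eqP; apply: contraTT by_ => a0; rewrite -leNgt leye_eq; apply/eqP.
      rewrite D2y gt0_muley ?addye//.
        rewrite gt_eqF//; apply: (@lt_le_trans _ _ 0); first exact: ltNy0.
        by rewrite !mule_ge0 ?lq_norm_ge0// lee_fin mulr_ge0// ltW.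
      by rewrite mule_gt0 ?lte_fin// lt0e a0 lq_norm_ge0.
    exists 0%R; split=> // s us; rewrite mul0r.
    under eq_integral => w _.
      rewrite big1 ?normr0; last by move=> i _; rewrite (@lq_norm_eq0 _ _ a 2 i)// mul0r.
      over.
    by rewrite integral0.
  have D2f : D2 \is a fin_num by rewrite ge0_fin_numE// ltey.
  pose K2 : R := (Num.sqrt 2 * (29 / 2 * 2 / ln 2))%R.
  have l2 : (0 < ln (2 : R))%R by rewrite ln_gt0//; lra.
  have K20 : (0 <= K2)%R by rewrite mulr_ge0// divr_ge0 ?mulr_ge0// ltW.
  exists ((K2 + K2 * Num.sqrt (2 - 1)) * fine D2)%R; split.
    by rewrite mulr_ge0 ?fine_ge0// addr_ge0// mulr_ge0.
  move=> s us.
  apply: le_trans (Lnorm1_le_Lnorm2 _ _) _; first exact: mS.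
  rewrite (Lnorm_shift_sum _ mf).
  apply: le_trans (finite_sum_norm inu mf (lexx 2%R) fp2 f0 hd a us (dlE 2%R) (dlE 2%R)) _.
  rewrite (_ : (d%:R * (1 - 1 / 2) = d%:R / 2 :> R)%R); last by field.
  rewrite -[sphere_series _ _]/D2 -(fineK D2f) -!EFinM -EFinD lee_fin.
  by rewrite -/K2 le_eqVlt; apply/orP; left; apply/eqP; ring.
have := @L1_complete _ T R P (fun k w => \sum_(i <- box_seq d k) a i * X i w)%R.
case.
- move=> k; apply/integrableP; split; first exact/measurable_EFinP.
  apply: le_lt_trans (HC _ (fset_uniq _)) _; exact: ltry.
- move=> e e0.
  have C1 : (0 < C + 1)%R by lra.
  (* An l^2 tail below [eta] has square root at most e / (C + 1), hence L^1 norm at most e; the 1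
     covers C = 0. *)
  pose eta : R := ((e / (C + 1)) ^+ 2)%R.
  have eta0 : (0 < eta)%R by rewrite exprn_gt0// divr_gt0.
  have [k0 Hk0] := lq_tail (ltr0Sn R 1) ha eta0.
  have main n m : (k0 <= m)%N -> (m <= n)%N ->
      \int[P]_w (`|\sum_(i <- box_seq d n) a i * X i w -
        \sum_(i <- box_seq d m) a i * X i w|%R)%:E <= e%:E.
    move=> km mn; under eq_integral do rewrite box_sumB//.
    set s := [seq i <- box_seq d n | (m < supnorm i)%N].
    have us : uniq s by exact/filter_uniq/fset_uniq.
    apply: le_trans (HC s us) _; rewrite lee_fin.
    have hs : (\sum_(i <- s) `|a i| `^ 2 <= eta)%R.
      apply: Hk0 => // i; rewrite mem_filter => /andP[mi _].
      exact: leq_ltn_trans mi.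
    have hs2 : ((\sum_(i <- s) `|a i| `^ 2) `^ 2^-1 <= e / (C + 1))%R.
      have e1 : (0 <= e / (C + 1))%R by rewrite divr_ge0// ltW.
      have -> : (e / (C + 1) = eta `^ 2^-1)%R.
        by rewrite powR12_sqrt ?sqr_ge0// sqrtr_sqr ger0_norm.
      apply: ge0_ler_powR => //; rewrite ?nnegrE ?(ltW eta0)//.
      by apply: sumr_ge0 => i _; exact: powR_ge0.
    apply: (@le_trans _ _ (C * (e / (C + 1))))%R; first by rewrite ler_wpM2l.
    by rewrite mulrCA ler_piMr ?ltW// ltr_pdivrMr//; lra.
  exists k0 => n m k0n k0m; have [mn|nm] := leqP m n; first exact: main.
  under eq_integral do rewrite distrC.
  by apply: main => //; exact: ltnW.
move=> S [iS cS]; exists S; split; first exact/Lfun1_integrable.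
rewrite (_ : (fun k => _) = fun k => \int[P]_w
    (`|\sum_(i <- box_seq d k) a i * X i w - S w|%R)%:E)//.
apply/funext => k; rewrite Lnorm1; apply: eq_integral => w _.
by rewrite /= box_sum.
Qed.
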